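(* Let $k\ge 2$ be even and $n\ge 2$, with $(k,n)\neq(2,2)$ (that is, excluding $Q_2^2\cong C_4$). Then the $k$-ary $n$-cube $Q_n^k$ is 2-DCC edge $[4,|Q_n^k|/2]$-bipancyclic, where $|Q_n^k|$ denotes the number of vertices of $Q_n^k$.
   Context: All graphs are finite, undirected and simple. $C_m$ denotes the cycle on $m$ vertices and $K_2$ the complete graph on two vertices. The Cartesian product $A\mathbin{\square}B$ has vertex set $V(A)\times V(B)$, with $(a,b)$ and $(a',b')$ adjacent iff either $a=a'$ and $bb'\in E(B)$, or $b=b'$ and $aa'\in E(A)$. Generalized hypercube: for $d_1,\ldots,d_n\ge 2$, $C(d_1,\ldots,d_n)=F_1\mathbin{\square}\cdots\mathbin{\square}F_n$, where $F_i=K_2$ if $d_i=2$ and $F_i=C_{d_i}$ if $d_i\ge 3$. For $k,n\ge 2$, the $k$-ary $n$-cube is $Q_n^k=C(k,k,\ldots,k)$ with $n$ factors. The length $|J|$ of a cycle $J$ is its number of edges. Two edges are independent if they have no common end. A two-disjoint-cycle cover (2-DCC) of a graph $H$ is a pair $(J_1,J_2)$ of cycles (subgraphs of $H$) with $V(J_1)\cap V(J_2)=\varnothing$ and $V(J_1)\cup V(J_2)=V(H)$. Let $H$ be a bipartite graph of order $m$ and let $4\le r_1\le r_2\le m/2$. $H$ is 2-DCC edge $[r_1,r_2]$-bipancyclic if for every ordered pair of independent edges $(e,f)$ of $H$ and every even integer $\ell$ with $r_1\le \ell\le r_2$, there is a 2-DCC $(J_1,J_2)$ of $H$ such that $|J_1|=\ell$,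 $|J_2|=m-\ell$, $e\in E(J_1)$ and $f\in E(J_2)$. *)

(* Defs.v *)
From HB Require Import structures.
From mathcomp Require Import all_boot.

Set Implicit Arguments.
Unset Strict Implicit.
Unset Printing Implicit Defensive.

Record sgraph := SGraph {
  vertex :> finType;
  adj : rel vertex;
  adj_sym : symmetric adj;
  adj_irrefl : irreflexive adj }.

Definition edges (H : sgraph) : {set {set H}} :=
  [set [set p.1; p.2] | p : H * H & adj p.1 p.2].

Definition bipartite (H : sgraph) : Prop :=
  exists A : {set H}, forall x y : H, adj x y -> (x \in A) != (y \in A).

Definition complete_rel m : rel 'I_m := fun i j => i != j.

Lemma complete_sym m : symmetric (@complete_rel m).
Proof. by move=> i j; rewrite /complete_rel eq_sym. Qed.

Lemma complete_irrefl m : irreflexive (@complete_rel m).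
Proof. by move=> i; rewrite /complete_rel eqxx. Qed.

Definition complete_graph m : sgraph :=
  SGraph (@complete_sym m) (@complete_irrefl m).

(* [ordS i] is i + 1 mod m; the guard [i != j] only matters for m = 1. *)
Definition cycle_rel m : rel 'I_m :=
  fun i j => (i != j) && ((j == ordS i) || (i == ordS j)).

Lemma cycle_rel_sym m : symmetric (@cycle_rel m).
Proof. by move=> i j; rewrite /cycle_rel eq_sym orbC. Qed.

Lemma cycle_rel_irrefl m : irreflexive (@cycle_rel m).
Proof. by move=> i; rewrite /cycle_rel eqxx. Qed.

Definition cycle_graph m : sgraph :=
  SGraph (@cycle_rel_sym m) (@cycle_rel_irrefl m).

Section CartesianProduct.
Variables A B : sgraph.

Definition cart_rel : rel (A * B) := fun u v =>
  ((u.1 == v.1) && adj u.2 v.2) || ((u.2 == v.2) && adj u.1 v.1).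

Lemma cart_sym : symmetric cart_rel.
Proof.
move=> u v; rewrite /cart_rel (eq_sym u.1) (eq_sym u.2).
by rewrite (@adj_sym A u.1) (@adj_sym B u.2).
Qed.

Lemma cart_irrefl : irreflexive cart_rel.
Proof. by move=> u; rewrite /cart_rel !adj_irrefl !andbF. Qed.

Definition cart_prod : sgraph := SGraph cart_sym cart_irrefl.
End CartesianProduct.

Definition hypercube_factor (d : nat) : sgraph :=
  if d == 2 then complete_graph 2 else cycle_graph d.

(* The product is associated to the right.  The empty product is a
   one-vertex graph. *)
Fixpoint gen_hypercube (d : seq nat) : sgraph :=
  match d with
  | [::] => complete_graph 1
  | [:: d1] => hypercube_factor d1
  | d1 :: d' => cart_prod (hypercube_factor d1) (gen_hypercube d')
  end.

Definition kary_cube (k n : nat) : sgraph := gen_hypercube (nseq n k).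

Section Cycles.
Variable H : sgraph.

(* A cycle of H is given by a cyclic enumeration c of its vertices; the
   subgraph itself is (cycle_vertices c, cycle_edges c). *)
Definition is_cycle (c : seq H) : Prop := 2 < size c /\ ucycle (@adj H) c.

Definition cycle_vertices (c : seq H) : {set H} := [set x in c].

Definition cycle_edges (c : seq H) : {set {set H}} :=
  [set [set x; next c x] | x in c].

Definition cycle_length (c : seq H) : nat := #|cycle_edges c|.

Definition two_dcc (J1 J2 : seq H) : Prop :=
  [/\ is_cycle J1, is_cycle J2,
      cycle_vertices J1 :&: cycle_vertices J2 = set0 &
      cycle_vertices J1 :|: cycle_vertices J2 = [set: H]].

End Cycles.

Definition two_dcc_edge_bipancyclic (H : sgraph) (r1 r2 : nat) : Prop :=
  [/\ bipartite H, 4 <= r1 <= r2, r2.*2 <= #|H| &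
      forall e f : {set H}, e \in edges H -> f \in edges H -> e :&: f = set0 ->
      forall l : nat, ~~ odd l -> r1 <= l <= r2 ->
      exists J1 J2 : seq H,
        [/\ two_dcc J1 J2, cycle_length J1 = l, cycle_length J2 = #|H| - l,
            e \in cycle_edges J1 & f \in cycle_edges J2]].

(* Main.v *)
Require Import Defs.
From mathcomp Require Import all_boot.
From mathcomp Require Import zify.

(** The proof has two halves.

    A torus C_a x C_b with a, b >= 4 even satisfies the conclusion
    (torus_dcc).  It is described by a chart, a doubly periodic map
    v : nat -> nat -> H, so that translations, row reflections and the exchange
    of the two directions are mere reindexings.  Two independent edges e, f can
    always be moved so that e starts at the origin and the rows met by f avoid
    rows 0 and 1 (normalize_pair): if in one direction e and f meet a common
    line, then in the other direction they do not.  After this the two cycles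
    are cut along rows.
    - If l <= b, the first cycle bounds a ladder of l/2 columns in rows 0 and 1;
      the other columns of these rows also bound a ladder, which is spliced into
      a Hamiltonian cycle of the remaining rows.
    - If l = h b + r > b, the first cycle takes h full rows and r vertices of
      the next row, and the second cycle takes everything else.  Since b and l
      are even, so is r, and the divided row splits into dominos, each of which
      replaces one edge in the neighbouring full row.  The bound l <= ab/2
      leaves at least a/2 >= 2 rows for the second cycle, enough for the rows
      met by f.
    Both cases rest on full_rows_cycle: consecutive rows of a torus have
    a Hamiltonian cycle through any prescribed edge that also keeps every second
    edge of the first row, and these edges are where dominos and ladders are
    attached.

    A cube Q_n^k reduces to a torus: any two edges of Q_n^k are edges of one
    spanning torus (toroidal_cube).  By induction, Q_n^k contains a spanning
    torus C_a x C_b through the projections of the two edges to the last n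
    factors of Q_(n+1)^k = F x Q_n^k (an edge along F projects to a vertex).
    A Hamiltonian cycle of F x C_b turns F x (C_a x C_b) into a torus
    C_a x C_(kb), and retains all the edges in the direction of C_a together
    with one further edge of our choice (fold_toroidal).  When both edges lie
    along F, the first two factors are exchanged beforehand.  The induction
    starts at C_k x C_k for k >= 4 and at Q_4 = C_4 x C_4 for k = 2, which leaves
    out only Q_3, whose covers consist of two opposite faces (Q3_faces). *)

Set Implicit Arguments.
Unset Strict Implicit.
Unset Printing Implicit Defensive.

(** * Splicing cycles *)

Lemma set2_inj (T : finType) (x y z t : T) :
  [set x; y] = [set z; t] -> (x = z /\ y = t) \/ (x = t /\ y = z).
Proof.
move=> E; have hx : x \in [set z; t] by rewrite -E set21.
have hy : y \in [set z; t] by rewrite -E set22.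
have hz : z \in [set x; y] by rewrite E set21.
have ht : t \in [set x; y] by rewrite E set22.
case/set2P: hx => ex; case/set2P: hy => ey; auto; subst;
  by move: hz ht; rewrite !inE !orbb => /eqP hz /eqP ht; subst; auto.
Qed.

Section CycleSurgery.
Variable H : sgraph.
Implicit Types (x y : H) (c p : seq H) (g : {set H}).

Lemma cycle_edges_rot n c : uniq c -> cycle_edges (rot n c) = cycle_edges c.
Proof.
move=> uc; apply/setP=> g.
apply/imsetP/imsetP=> -[x xc ->]; exists x; rewrite ?mem_rot // ?next_rot //.
by rewrite mem_rot in xc.
Qed.

Lemma cycle_edges_rev c : uniq c -> cycle_edges (rev c) = cycle_edges c.
Proof.
move=> uc; apply/setP=> g; apply/imsetP/imsetP=> -[x].
  rewrite mem_rev => xc ->; exists (prev c x); first by rewrite mem_prev.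
  by rewrite next_rev // next_prev // setUC.
move=> xc ->; exists (next c x); first by rewrite mem_rev mem_next.
by rewrite next_rev // prev_next // setUC.
Qed.

Lemma is_cycle_rot n c : is_cycle (rot n c) <-> is_cycle c.
Proof. by rewrite /is_cycle size_rot /ucycle rot_uniq rot_cycle. Qed.

Lemma is_cycle_rev c : is_cycle (rev c) <-> is_cycle c.
Proof.
rewrite /is_cycle size_rev /ucycle rev_uniq rev_cycle.
by rewrite (eq_cycle (e' := @adj H)) // => x y; rewrite adj_sym.
Qed.

(** Rotating and reversing the enumeration, any edge of a cycle can be made its
    closing edge, with either end in front; the cycle minus that edge is then
    a Hamiltonian path between the two ends. *)
Lemma cycle_open c x y : is_cycle c -> [set x; y] \in cycle_edges c ->
  exists p, [/\ is_cycle (x :: p), last x p = y, perm_eq (x :: p) c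
              & cycle_edges (x :: p) = cycle_edges c].
Proof.
move=> cc /imsetP[z zc]; set z' := next c z => exy.
have uc : uniq c by case: cc => _ /andP[].
have z'c : z' \in c by rewrite mem_next.
have [n p Ec] := rot_to z'c.
have last_p : last z' p = z.
  have urp : uniq (z' :: p) by rewrite -Ec rot_uniq.
  have := cycle_next urp; rewrite -Ec (eq_cycle (e' := frel (next c))); last first.
    by move=> u w /=; rewrite next_rot.
  rewrite Ec /= rcons_path => /andP[_ /= /eqP en].
  by rewrite -[LHS](prev_next uc) en /z' prev_next.
have cp : is_cycle (z' :: p) by rewrite -Ec; apply/is_cycle_rot.
have up : uniq (z' :: p) by case: cp => _ /andP[].
have pp : perm_eq (z' :: p) c by rewrite -Ec perm_rot.
have ep : cycle_edges (z' :: p) = cycle_edges c by rewrite -Ec cycle_edges_rot.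
case: (set2_inj exy) => -[-> ->].
  have zrp : z' :: p = rcons (belast z' p) z by rewrite -last_p -lastI.
  exists (rev (belast z' p)); have er : z :: rev (belast z' p) = rev (z' :: p).
    by rewrite zrp rev_rcons.
  rewrite er; split.
  - exact/is_cycle_rev.
  - case: (p) last_p => [|w q] /=; first by move=> ->.
    by rewrite rev_cons last_rcons.
  - by rewrite perm_rev.
  - by rewrite cycle_edges_rev.
by exists p.
Qed.

(** The edges read off as consecutive pairs, which unlike next behaves well under
    concatenation. *)
Lemma cycle_edgesE x p g : uniq (x :: p) ->
  (g \in cycle_edges (x :: p)) =
  (g \in pairmap (fun y z => [set y; z]) x (rcons p x)).
Proof.
move=> up; have := cycle_next up; rewrite /cycle_edges /=.
set f := next _ => fp.
have E q z : path (frel f) z q ->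
    pairmap (fun y z => [set y; z]) z q = [seq [set y; f y] | y <- belast z q].
  by elim: q z => //= y q IH z /andP[/eqP <- /IH ->].
rewrite (E _ _ fp) belast_rcons.
by apply/imsetP/mapP => -[y yc ->]; exists y.
Qed.

Lemma cycle_lengthE c : is_cycle c -> cycle_length c = size c.
Proof.
case=> sc /andP[_ uc]; rewrite /cycle_length /cycle_edges card_in_imset.
  by rewrite (card_uniqP uc).
move=> x y xc yc /set2_inj [[]//|[exy eyx]].
have [n p Ec] := rot_to xc.
have up : uniq (x :: p) by rewrite -Ec rot_uniq.
have sp : 2 < size (x :: p) by rewrite -Ec size_rot.
have : next (x :: p) (next (x :: p) x) = x.
  by rewrite -Ec !next_rot // eyx -exy.
case: p {Ec} up sp => [|u [|w p]] //= /and3P[+ _ _] _.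
rewrite !inE !negb_or !eqxx => /and3P[nxu nxw _].
by rewrite eq_sym (negPf nxu) => wx; rewrite wx eqxx in nxw.
Qed.

(** Inserting a path between the last and the first vertex of a cycle destroys only
    the closing edge. *)
Lemma cycle_join x1 p1 x2 p2 : is_cycle (x1 :: p1) ->
    path (@adj H) x2 p2 -> uniq (x2 :: p2) -> [disjoint x1 :: p1 & x2 :: p2] ->
    adj (last x1 p1) x2 -> adj (last x2 p2) x1 ->
  let c := x1 :: p1 ++ x2 :: p2 in
  [/\ is_cycle c,
      forall g, g \in cycle_edges (x1 :: p1) -> g != [set x1; last x1 p1] ->
        g \in cycle_edges c,
      {subset pairmap (fun y z => [set y; z]) x2 p2 <= cycle_edges c},
      [set last x1 p1; x2] \in cycle_edges c &
      [set last x2 p2; x1] \in cycle_edges c].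
Proof.
move=> [s1 /andP[c1 u1]] pp2 u2 dis a12 a21 c.
have uc : uniq c.
  by rewrite /c -cat_cons cat_uniq u1 u2 -disjoint_has disjoint_sym dis.
have cE g : (g \in cycle_edges c) =
   (g \in pairmap (fun y z => [set y; z]) x1 p1) ||
   ((g == [set last x1 p1; x2]) ||
   ((g \in pairmap (fun y z => [set y; z]) x2 p2) || (g == [set last x2 p2; x1]))).
  rewrite cycle_edgesE // rcons_cat pairmap_cat mem_cat /= inE.
  by rewrite -cats1 pairmap_cat mem_cat /= mem_seq1.
split.
- split; first by rewrite /c /= size_cat /=; move: s1 => /=; lia.
  rewrite /ucycle uc andbT /c /= rcons_cat cat_path /= rcons_path.
  by move: c1; rewrite /= rcons_path a12 a21 pp2 => /andP[-> _].
- move=> g; rewrite cycle_edgesE // -cats1 pairmap_cat mem_cat /= mem_seq1 cE.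
  by rewrite [[set last x1 p1; x1]]setUC; case/orP=> -> //; rewrite orbT.
- by move=> g gp; rewrite cE gp !orbT.
- by rewrite cE eqxx !orbT.
- by rewrite cE eqxx !orbT.
Qed.

(** Two disjoint cycles with a pair of parallel edges form a square with them;
    exchanging these two edges for the two other sides of the square merges the
    cycles. *)
Lemma cycle_splice c1 c2 x1 y1 x2 y2 :
    is_cycle c1 -> is_cycle c2 -> [disjoint c1 & c2] ->
    [set x1; y1] \in cycle_edges c1 -> [set x2; y2] \in cycle_edges c2 ->
    adj x1 x2 -> adj y1 y2 ->
  exists c, [/\ is_cycle c, perm_eq c (c1 ++ c2),
    forall g, g \in cycle_edges c1 -> g != [set x1; y1] -> g \in cycle_edges c,
    forall g, g \in cycle_edges c2 -> g != [set x2; y2] -> g \in cycle_edges c &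
    [set x1; x2] \in cycle_edges c /\ [set y1; y2] \in cycle_edges c].
Proof.
move=> cc1 cc2 dis e1 e2 ax ay.
have [p1 [cp1 l1 pp1 <-]] := cycle_open cc1 e1.
rewrite setUC in e2; have [p2 [cp2 l2 pp2 <-]] := cycle_open cc2 e2.
have [s2 /andP[]] := cp2; rewrite /= rcons_path => /andP[pth _] up2.
have dis' : [disjoint x1 :: p1 & y2 :: p2].
  by rewrite (eq_disjoint (perm_mem pp1)) (eq_disjoint_r (perm_mem pp2)).
have [] := cycle_join cp1 pth up2 dis'; rewrite ?l1 ?l2 //.
  by rewrite adj_sym.
move=> cc K1 K2 E1 E2; exists (x1 :: p1 ++ y2 :: p2); split=> //.
- by rewrite -cat_cons perm_cat.
- move=> g; rewrite cycle_edgesE // -cats1 pairmap_cat mem_cat /= mem_seq1 l2.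
  by case/orP=> [/K2//|/eqP ->]; rewrite eqxx.
- by rewrite setUC.
Qed.

(** The same exchange when the second cycle degenerates to a single edge. *)
Lemma cycle_absorb c x1 y1 x2 y2 :
    is_cycle c -> x2 \notin c -> y2 \notin c -> [set x1; y1] \in cycle_edges c ->
    adj x1 x2 -> adj y1 y2 -> adj x2 y2 ->
  exists c', [/\ is_cycle c', perm_eq c' (c ++ [:: x2; y2]),
    forall g, g \in cycle_edges c -> g != [set x1; y1] -> g \in cycle_edges c',
    [set x2; y2] \in cycle_edges c' &
    [set x1; x2] \in cycle_edges c' /\ [set y1; y2] \in cycle_edges c'].
Proof.
move=> cc nx2 ny2 e1 ax ay a2.
have [p1 [cp1 l1 pp1 <-]] := cycle_open cc e1.
have up2 : uniq [:: y2; x2].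
  by rewrite /= inE andbT; apply: contraTneq a2 => ->; rewrite adj_irrefl.
have dis' : [disjoint x1 :: p1 & [:: y2; x2]].
  by rewrite (eq_disjoint (perm_mem pp1)) disjoint_sym disjoint_has /= orbF
     negb_or ny2 nx2.
have [] := cycle_join cp1 _ up2 dis'; rewrite ?l1 //= ?andbT 1?adj_sym //.
move=> cc' K1 K2 E1 E2; exists (x1 :: p1 ++ [:: y2; x2]); split=> //.
- rewrite -cat_cons perm_cat //.
  by rewrite -[X in perm_eq _ X]/(rev [:: y2; x2]) perm_sym perm_rev.
- by apply: K2; rewrite inE setUC.
- by rewrite setUC.
Qed.
End CycleSurgery.

(** * Hamiltonian cycles of cylinders *)

Lemma cong_window b s j j' : s <= j < s + b -> s <= j' < s + b ->
  j = j' %[mod b] -> j = j'.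
Proof.
move=> /andP[sj jb] /andP[sj' j'b] /eqP.
rewrite -(subnKC sj) -(subnKC sj') eqn_modDl !modn_small ?ltn_subLR //.
by move=> /eqP ->.
Qed.

Section Cylinder.
Variable H : sgraph.
Implicit Types (u : nat -> nat -> H) (g : {set H}).

Definition hedge u i j : {set H} := [set u i j; u i j.+1].
Definition vedge u i j : {set H} := [set u i j; u i.+1 j].

Definition grid_edge u m g : Prop :=
  (exists i j, i < m /\ g = hedge u i j) \/
  (exists i j, i.+1 < m /\ g = vedge u i j).

(** Columns are read modulo b but rows are not cyclic, so every window of rows of
    a torus, read in either direction, is a cylinder.  Since b is even, the parity
    of a column is meaningful. *)
Record cylinder u (m b : nat) : Prop := Cylinder {
  cyl_gt3 : 3 < b;
  cyl_even : ~~ odd b;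
  cyl_per : forall i j, i < m -> u i (j + b) = u i j;
  cyl_hadj : forall i j, i < m -> adj (u i j) (u i j.+1);
  cyl_vadj : forall i j, i.+1 < m -> adj (u i j) (u i.+1 j);
  cyl_inj : forall i j i' j', i < m -> i' < m -> u i j = u i' j' ->
    i = i' /\ j = j' %[mod b] }.

Lemma circuit_cycle (f : nat -> H) b : 2 < b ->
    (forall j, adj (f j) (f j.+1)) -> (forall j, f (j + b) = f j) ->
    (forall j j', f j = f j' -> j = j' %[mod b]) ->
  is_cycle (mkseq f b) /\
  forall j, [set f j; f j.+1] \in cycle_edges (mkseq f b).
Proof.
case: b => // b b2 fadj fper finj; set c := mkseq f b.+1.
have uc : uniq c.
  apply/mkseq_uniqP => j j' /[!inE] jb j'b /finj.
  by rewrite !modn_small.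
have cE : rcons (map f (iota 1 b)) (f 0) = map f (iota 1 b.+1).
  by rewrite -(fper 0) add0n -map_rcons -{2}[b.+1]addn1 iotaD cats1.
have pE n s : path (@adj H) (f s) (map f (iota s.+1 n)).
  by elim: n s => //= n IH s; rewrite fadj IH.
have mE n s : pairmap (fun y z => [set y; z]) (f s) (map f (iota s.+1 n)) =
    [seq [set f j; f j.+1] | j <- iota s n].
  by elim: n s => //= n IH s; rewrite IH.
split.
  split; first by rewrite size_mkseq.
  by rewrite /ucycle uc andbT /c /mkseq /= cE pE.
move=> j; have -> : [set f j; f j.+1] = [set f (j %% b.+1); f (j %% b.+1).+1].
  have fm q s : f (s + q * b.+1) = f s.
    by elim: q s => [|q IH] s; rewrite ?addn0 // mulSnr addnA fper.
  by rewrite {1 2}(divn_eq j b.+1) addnC -addSn !fm.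
have := cycle_edgesE _ uc; rewrite /c /mkseq /= => ->; rewrite cE mE.
apply/mapP; exists (j %% b.+1) => //.
by rewrite mem_iota /= add0n ltn_mod.
Qed.

Section CylTheory.
Variables (u : nat -> nat -> H) (m b : nat).
Hypothesis cu : cylinder u m b.

Lemma odd_cong j j' : j = j' %[mod b] -> odd j = odd j'.
Proof.
have bE := negPf (cyl_even cu) => E.
by rewrite -(@odd_mod j b bE) E odd_mod.
Qed.

Lemma ncong2 j : j <> j.+2 %[mod b].
Proof.
have b4 := cyl_gt3 cu.
rewrite -[j.+2]addn2 -{1}[j]addn0 => /eqP; rewrite eqn_modDl !modn_small //; lia.
Qed.

Lemma hedge_inj i j i' j' : i < m -> i' < m ->
  hedge u i j = hedge u i' j' -> i = i' /\ j = j' %[mod b].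
Proof.
move=> im i'm /set2_inj [[E1 _]|[E1 E2]]; first exact: (cyl_inj cu im i'm E1).
have [_ J1] := cyl_inj cu im i'm E1; have [_ J2] := cyl_inj cu im i'm E2.
case: (@ncong2 j'); rewrite -J2 -addn1 -[in RHS]addn1.
by apply/eqP; rewrite eqn_modDr; apply/eqP.
Qed.

Lemma vedge_neq_hedge i j i' j' : i.+1 < m -> i' < m ->
  vedge u i j <> hedge u i' j'.
Proof.
move=> im i'm /set2_inj [] [E1 E2];
have [? _] := cyl_inj cu (ltnW im) i'm E1; have [? _] := cyl_inj cu im i'm E2; lia.
Qed.

(** As b >= 4, each parity class contains at least two columns modulo b. *)
Lemma avoid_cong (q : bool) j : exists2 k, odd k = q & k <> j %[mod b].
Proof.
have [E|/eqP N] := eqVneq (nat_of_bool q %% b) (j %% b); last first.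
  by exists q => //; rewrite oddb.
exists (nat_of_bool q).+2; first by rewrite /= negbK oddb.
by rewrite -E => E'; apply: (@ncong2 q).
Qed.

Lemma row_cycle i : i < m -> exists c, [/\ is_cycle c, size c = b,
  forall x, x \in c -> exists j, x = u i j &
  forall j, hedge u i j \in cycle_edges c].
Proof.
move=> im; have [] := @circuit_cycle (u i) b.
- exact: ltnW (cyl_gt3 cu).
- by move=> j; apply: (cyl_hadj cu).
- by move=> j; apply: (cyl_per cu).
- by move=> j j' /(cyl_inj cu im im) [].
move=> cc ee; exists (mkseq (u i) b); split=> //; first exact: size_mkseq.
by move=> x /mapP[j _ ->]; exists j.
Qed.

End CylTheory.

Lemma cylinder_shift u m b k : cylinder u (k + m) b ->
  cylinder (fun i => u (k + i)) m b.
Proof.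
case=> b4 be per ha va inj; split=> //.
- by move=> i j im; apply: per; lia.
- by move=> i j im; apply: ha; lia.
- by move=> i j im; rewrite addnS; apply: va; lia.
- by move=> i j i' j' im i'm /inj []; lia.
Qed.

(** Induction on the number of rows: the cycle of the first row is spliced with
    a cycle of the remaining rows at a column of the parity opposite to p, so that
    the edges of parity p in the first row survive; the induction hypothesis for the
    opposite parity provides the parallel edge in the second row.  The splicing
    column is chosen so that it creates g if g joins the first two rows, and does
    not destroy g otherwise. *)
Lemma full_rows_cycle m u b (p : bool) g :
  cylinder u m.+1 b -> grid_edge u m.+1 g ->
  exists c, [/\ is_cycle c, size c = m.+1 * b,
    forall x, x \in c -> exists i j, i < m.+1 /\ x = u i j,
    g \in cycle_edges c &
    forall j, odd j = p -> hedge u 0 j \in cycle_edges c].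
Proof.
elim: m u p g => [|m IH] u p g cu gu.
  have [c [cc sc xc ec]] := row_cycle cu (ltn0Sn 0).
  exists c; split=> //; first by rewrite mul1n.
    by move=> x /xc [j ->]; exists 0, j.
  case: gu => [[i [j [im ->]]]|[i [j []]]//].
  by case: i im => // _; apply: ec.
have cu' := cylinder_shift (k := 1) cu.
set u' := fun i => u (1 + i) in cu'.
have [c0 [cc0 sc0 xc0 ec0]] := row_cycle cu (ltn0Sn _).
(* The splicing column k, the edge g' to request from the remaining rows, and how
   g then survives: in the first row, as one of the two new vertical edges, or in
   the remaining rows. *)
have [k [g' [ok gu' gk]]] : exists k g', [/\ odd k = ~~ p, grid_edge u' m.+1 g' &
  [\/ exists2 j, g = hedge u 0 j & k <> j %[mod b],
      g = vedge u 0 k \/ g = vedge u 0 k.+1 |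
      g = g' /\ g' <> hedge u' 0 k]].
  case: gu => [[[|i] [j [im ->]]]|[[|i] [j [im ->]]]].
  - have [k ok nk] := avoid_cong cu (~~ p) j.
    exists k, (hedge u' 0 0); split=> //; first by left; exists 0, 0.
    by constructor 1; exists j.
  - have [k ok nk] := avoid_cong cu (~~ p) j.
    exists k, (hedge u' i j); split=> //; first by left; exists i, j.
    constructor 3; split=> // E.
    by have [_ /esym] := hedge_inj cu' im (ltn0Sn m) E.
  (* Splicing at k creates the vertical edges of columns k and k + 1, and j or j - 1
     has the right parity; b is added so that j - 1 makes sense for j = 0. *)
  - exists (if odd j == ~~ p then j else (j + b).-1), (hedge u' 0 0).
    have b4 := cyl_gt3 cu; have be := cyl_even cu.
    split; first by case: eqP => //; lia.
      by left; exists 0, 0.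
    constructor 2; case: eqP => _; [by left|right].
    by rewrite prednK ?addn_gt0 ?(ltn_trans _ b4) ?orbT // /vedge !(cyl_per cu).
  - exists (nat_of_bool (~~ p)), (vedge u' i j); split.
    + by case: (p).
    + by right; exists i, j.
    + constructor 3; split=> // E.
      exact: (vedge_neq_hedge cu' im (ltn0Sn m) E).
have [c1 [cc1 sc1 xc1 gc1 ec1]] := IH u' (~~ p) g' cu' gu'.
have dis : [disjoint c0 & c1].
  rewrite disjoint_has; apply/hasPn => x /xc0[j ->]; apply/negP => /xc1.
  by move=> [i [j' [im /(cyl_inj cu)]]] [].
have [c [cc pc k0 k1 [kv kv']]] := cycle_splice cc0 cc1 dis (ec0 k) (ec1 k ok)
  (cyl_vadj cu _ (isT : 1 < m.+2)) (cyl_vadj cu _ (isT : 1 < m.+2)).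
exists c; split=> //.
- by rewrite (perm_size pc) size_cat sc0 sc1; lia.
- move=> x; rewrite (perm_mem pc) mem_cat => /orP[/xc0[j ->]|/xc1[i [j [im ->]]]].
    by exists 0, j.
  by exists i.+1, j.
- case: gk => [[j -> nkj]|[->|->]//|[-> /eqP ngk]].
    apply: k0 => //; apply/eqP => /(hedge_inj cu)[]//.
    by move=> _ /esym.
  exact: k1.
- move=> j oj; apply: k0 => //; apply/eqP => /(hedge_inj cu)[]// _.
  by move/(odd_cong cu); rewrite oj ok; case: (p).
Qed.

(** Each domino of row 0 is absorbed through the parallel edge of row 1.  These
    edges have even columns, hence are pairwise disjoint, and no absorption spoils
    a later one. *)
Lemma add_dominos m u b c d n : cylinder u m b -> 1 < m -> (d + n).*2 <= b ->
    is_cycle c -> (forall x, x \in c -> exists i j, 0 < i < m /\ x = u i j) ->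
    (forall j, ~~ odd j -> hedge u 1 j \in cycle_edges c) ->
  exists c', [/\ is_cycle c', size c' = size c + n.*2,
    forall x, x \in c' -> (exists i j, 0 < i < m /\ x = u i j) \/
      (exists j, d.*2 <= j < (d + n).*2 /\ x = u 0 j),
    forall g, g \in cycle_edges c ->
      (forall j, ~~ odd j -> d.*2 <= j < (d + n).*2 -> g <> hedge u 1 j) ->
      g \in cycle_edges c' &
    forall j, d.*2 <= j < (d + n).*2 -> vedge u 0 j \in cycle_edges c'].
Proof.
move=> cu m2 + cc xc ec; have m0 := ltnW m2.
elim: n => [_|n IH dn].
  exists c; split=> //; first by rewrite addn0.
    by move=> x /xc; left.
  by move=> j; rewrite addn0; lia.
have [|c' [cc' sc' xc' ec' vc']] := IH; first by lia.
set k := (d + n).*2; have ok : ~~ odd k by rewrite odd_double.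
have kb : k.+1 < b by rewrite /k; lia.
have nx j : k <= j < k.+2 -> u 0 j \notin c'.
  move=> kj; apply/negP => /xc' [[i [j' [ /andP[i0 im]]]]|[j' [dj']]] /(cyl_inj cu).
    by move=> /(_ m0 im)[]; lia.
  move=> /(_ m0 m0)[_ /(@cong_window b 0)]; lia.
have ek : hedge u 1 k \in cycle_edges c'.
  apply: ec' => [|j oj dj /(hedge_inj cu) []//]; first exact: ec.
  by move=> _ /(@cong_window b 0); lia.
have av j : adj (u 1 j) (u 0 j) by rewrite adj_sym; apply: (cyl_vadj cu).
have [] := cycle_absorb cc' (nx k _) (nx k.+1 _) ek (av k) (av k.+1)
  (cyl_hadj cu _ m0); try lia.
move=> c2 [cc2 pc2 kc2 _ [vk vk1]]; exists c2; split=> //.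
- by rewrite (perm_size pc2) size_cat sc' /=; lia.
- move=> x; rewrite (perm_mem pc2) mem_cat !inE => /orP[/xc'[|[j [dj ->]]]|].
  + by left.
  + by right; exists j; split=> //; lia.
  + by case/orP=> /eqP->; right; [exists k|exists k.+1]; split=> //; lia.
- move=> g gc ng; apply: kc2; last first.
    by apply/eqP; apply: ng => //; rewrite /k; lia.
  by apply: ec' => // j oj dj; apply: ng => //; lia.
- move=> j dj.
  have [jk|[->|->]] : j < k \/ j = k \/ j = k.+1 by lia.
  + apply: kc2; first by apply: vc'; lia.
    by apply/eqP; apply: (vedge_neq_hedge cu).
  + by rewrite /vedge setUC.
  + by rewrite /vedge setUC.
Qed.

(** The shape of each of the two cycles when they share a row: rows 1 to m + 1
    entirely, and from row 0 the dominos d, ..., d + n - 1.  A horizontal edge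
    of row 1 can be requested unless a domino is attached to it; every vertical edge
    between row 0 and row 1 above a domino is used. *)
Lemma fringed_cycle m u b d n g : cylinder u m.+2 b -> (d + n).*2 <= b ->
    (exists i j, [/\ 0 < i < m.+2, g = hedge u i j &
       [|| 1 < i, odd j | (j < b) && ~~ (d.*2 <= j < (d + n).*2)]]) \/
    (exists i j, [/\ i.+1 < m.+2, g = vedge u i j &
       (0 < i) || (d.*2 <= j < (d + n).*2)]) ->
  exists c, [/\ is_cycle c, size c = m.+1 * b + n.*2,
    forall x, x \in c -> (exists i j, 0 < i < m.+2 /\ x = u i j) \/
      (exists j, d.*2 <= j < (d + n).*2 /\ x = u 0 j) &
    g \in cycle_edges c].
Proof.
move=> cu dn gu; have cu' := cylinder_shift (k := 1) cu.
set u' := fun i => u (1 + i) in cu'.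
have [g' [gu' gg]] : exists g', grid_edge u' m.+1 g' /\
    ((g = g' /\ forall j, ~~ odd j -> d.*2 <= j < (d + n).*2 -> g <> hedge u 1 j)
     \/ exists2 j, d.*2 <= j < (d + n).*2 & g = vedge u 0 j).
  case: gu => [[[|i] [j [//= im -> hj]]]|[[|i] [j [im -> hj]]]].
  - exists (hedge u' i j); split; first by left; exists i, j.
    left; split=> // j' oj' dj' /(hedge_inj cu)[]//.
    case=> E JJ; move: hj; rewrite E ltnn /=.
    rewrite (odd_cong cu JJ) (negPf oj') /= => /andP[jb].
    by rewrite (@cong_window b 0 j j') ?dj' //; lia.
  - exists (hedge u' 0 0); split; first by left; exists 0, 0.
    by right; exists j.
  - exists (vedge u' i j); split; first by right; exists i, j.
    by left; split=> // j' _ _; apply: (vedge_neq_hedge cu).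
have [c [cc sc xc gc ec]] := @full_rows_cycle m u' b false g' cu' gu'.
have [] := @add_dominos m.+2 u b c d n cu _ dn cc => //.
- by move=> x /xc[i [j [im ->]]]; exists i.+1, j.
- by move=> j oj; apply: ec; apply: negbTE.
move=> c' [cc' sc' xc' ec' vc']; exists c'; split=> //.
  by rewrite sc' sc.
by case: gg => [[-> ng]|[j dj ->]]; [apply: ec'|apply: vc'].
Qed.

(** The boundary of a ladder, grown by absorbing one rung at a time through the
    last rung. *)
Lemma ladder_cycle u b s n : cylinder u 2 b -> 1 < n <= b ->
  exists c, [/\ is_cycle c, size c = n.*2,
    forall x, x \in c -> exists i j, [/\ i < 2, s <= j < s + n & x = u i j] &
    [/\ hedge u 0 s \in cycle_edges c, hedge u 1 s \in cycle_edges c &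
        vedge u 0 s \in cycle_edges c]].
Proof.
move=> cu nb; have b4 := cyl_gt3 cu.
suff [c [cc sc xc ec _]] : exists c, [/\ is_cycle c, size c = n.*2,
    forall x, x \in c -> exists i j, [/\ i < 2, s <= j < s + n & x = u i j],
    [/\ hedge u 0 s \in cycle_edges c, hedge u 1 s \in cycle_edges c &
        vedge u 0 s \in cycle_edges c] & vedge u 0 (s + n).-1 \in cycle_edges c].
  by exists c.
have neq i j i' j' : i < 2 -> i' < 2 -> s <= j < s + b -> s <= j' < s + b ->
    u i j = u i' j' -> i = i' /\ j = j'.
  move=> im i'm js j's /(cyl_inj cu im i'm)[-> JJ]; split=> //.
  exact: (cong_window js j's JJ).
case: n nb => [//|[//|n]]; elim: n => [|n IH] nb.
  set c := [:: u 0 s; u 0 s.+1; u 1 s.+1; u 1 s].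
  have uc : uniq c.
    rewrite /c /= !inE !negb_or !andbT; do ![apply/andP; split];
      by apply/eqP => /neq; lia.
  have cc : is_cycle c.
    split=> //; rewrite /ucycle uc andbT /= (cyl_hadj cu) //.
    rewrite (cyl_vadj cu) // adj_sym (cyl_hadj cu) //= adj_sym.
    by rewrite (cyl_vadj cu).
  exists c; split=> //.
  - move=> x; rewrite !inE => /or4P[] /eqP->.
    + by exists 0, s; split=> //; lia.
    + by exists 0, s.+1; split=> //; lia.
    + by exists 1, s.+1; split=> //; lia.
    + by exists 1, s; split=> //; lia.
  - rewrite !cycle_edgesE //= !inE eqxx; split=> //.
      by rewrite /hedge setUC eqxx !orbT.
    by rewrite /vedge setUC eqxx !orbT.
  - by rewrite cycle_edgesE //= addn2 /= !inE eqxx !orbT.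
have [|c [cc sc xc [h0 h1 v0] vn]] := IH; first by lia.
have nx i : i < 2 -> u i (s + n.+2) \notin c.
  move=> im; apply/negP => /xc[i' [j' [i'm j's /neq]]]; lia.
have kb : (s + n.+2).-1.+1 = s + n.+2 by lia.
have ha i : i < 2 -> adj (u i (s + n.+2).-1) (u i (s + n.+2)).
  by move=> im; rewrite -kb; apply: (cyl_hadj cu).
have [] := cycle_absorb cc (nx 0 isT) (nx 1 isT) vn (ha 0 isT) (ha 1 isT)
  (cyl_vadj cu _ (isT : 1 < 2)).
move=> c2 [cc2 pc2 kc2 vk [ex ey]].
have nv i j j' : i < 2 -> vedge u 0 j <> hedge u i j'.
  by move=> im; apply: (vedge_neq_hedge cu).
exists c2; split=> //.
- by rewrite (perm_size pc2) size_cat sc /=; lia.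
- move=> x; rewrite (perm_mem pc2) mem_cat !inE => /orP[/xc[i [j [im js ->]]]|].
    by exists i, j; split=> //; lia.
  by case/orP=> /eqP->; [exists 0, (s + n.+2)|exists 1, (s + n.+2)];
    split=> //; lia.
- split; apply: kc2 => //; try by apply/eqP => /esym/nv; apply.
  by apply/eqP => /set2_inj[[/neq]|[/neq]]; lia.
- by rewrite addnS.
Qed.
End Cylinder.

(** * Toroidal charts *)

Section Torus.
Variable H : sgraph.
Implicit Types (v : nat -> nat -> H) (e f g : {set H}).

Record chart v (a b : nat) : Prop := Chart {
  chart_gt3 : 3 < a /\ 3 < b;
  chart_even : ~~ odd a /\ ~~ odd b;
  chart_card : #|H| = a * b;
  chart_rper : forall i j, v (i + a) j = v i j;
  chart_cper : forall i j, v i (j + b) = v i j;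
  chart_hadj : forall i j, adj (v i j) (v i j.+1);
  chart_vadj : forall i j, adj (v i j) (v i.+1 j);
  chart_inj : forall i j i' j', v i j = v i' j' ->
    i = i' %[mod a] /\ j = j' %[mod b] }.

Definition chart_edge v g : Prop :=
  (exists i j, g = hedge v i j) \/ (exists i j, g = vedge v i j).

Lemma chart_cong v a b i j i' j' : chart v a b ->
  i = i' %[mod a] -> j = j' %[mod b] -> v i j = v i' j'.
Proof.
move=> cv ei ej.
have rowm k x y : v (x + k * a) y = v x y.
  by elim: k => [|k IH]; rewrite ?addn0 // mulSnr addnA (chart_rper cv).
have colm k x y : v x (y + k * b) = v x y.
  by elim: k => [|k IH]; rewrite ?addn0 // mulSnr addnA (chart_cper cv).
rewrite (divn_eq i a) (divn_eq j b) (divn_eq i' a) (divn_eq j' b) ei ej.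
by rewrite ![_ * _ + _]addnC !rowm !colm.
Qed.

Lemma chart_shift v a b s t : chart v a b ->
  chart (fun i j => v (i + s) (j + t)) a b.
Proof.
case=> g3 ev card rp cp ha va inj; split=> //.
- by move=> i j; rewrite addnAC rp.
- by move=> i j; rewrite [j + b + t]addnAC cp.
- move=> i j i' j' /inj[] /eqP + /eqP.
  by rewrite !eqn_modDr => /eqP ? /eqP ?.
Qed.

Lemma chart_swap v a b : chart v a b -> chart (fun i j => v j i) b a.
Proof.
case=> [[g1 g2] [e1 e2] card rp cp ha va inj]; split=> //.
- by rewrite mulnC.
- by move=> i j i' j' /inj[].
Qed.

(** The factor a.-1 acts as -1 modulo a, so this reindexing is the reflection
    of the rows sending i to c - i, without leaving the natural numbers. *)
Definition reflect_rows v a c i j := v (c + a.-1 * i) j.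

Lemma reflect_rowsE v a b c i j : chart v a b -> i <= c ->
  reflect_rows v a c i j = v (c - i) j.
Proof.
move=> cv ic; apply: (chart_cong cv) => //.
have [a3 _] := chart_gt3 cv; have -> : c + a.-1 * i = c - i + i * a by nia.
by rewrite addnC modnMDl.
Qed.

Lemma chart_reflect v a b c : chart v a b -> chart (reflect_rows v a c) a b.
Proof.
move=> cv; have [g3 ev card rp cp ha va inj] := cv.
rewrite /reflect_rows; split=> //.
- move=> i j; apply: (chart_cong cv) => //.
  by rewrite mulnDr addnA addnC modnMDl.
- move=> i j; rewrite mulnS.
  have -> : v (c + a.-1 * i) j = v (c + (a.-1 + a.-1 * i)).+1 j.
    rewrite -rp; congr (v _ j); case: g3; lia.
  by rewrite adj_sym.
- move=> i j i' j' /inj[/eqP + ->]; rewrite eqn_modDl => E; split=> //.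
  have a0 : 0 < a by case: g3; lia.
  apply/eqP; move: E; rewrite -(eqn_modDr (i + i')).
  have -> : a.-1 * i + (i + i') = i * a + i' by nia.
  have -> : a.-1 * i' + (i + i') = i' * a + i by nia.
  by rewrite !modnMDl eq_sym.
Qed.

Lemma hedge_reflect v a b c i j : chart v a b -> i <= c ->
  hedge v i j = hedge (reflect_rows v a c) (c - i) j.
Proof.
by move=> cv ic; rewrite /hedge !(reflect_rowsE _ cv) ?leq_subr // subKn.
Qed.

Lemma vedge_reflect v a b c i j : chart v a b -> i < c ->
  vedge v i j = vedge (reflect_rows v a c) (c - i.+1) j.
Proof.
move=> cv ic; rewrite /vedge !(reflect_rowsE _ cv) ?leq_subr //; last by lia.
by rewrite subnSK // !subKn // 1?setUC // ltnW.
Qed.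

Lemma hedge_cong v a b i j i' j' : chart v a b ->
  i = i' %[mod a] -> j = j' %[mod b] -> hedge v i j = hedge v i' j'.
Proof.
move=> cv ei ej; rewrite /hedge (chart_cong cv ei ej).
have ej1 : j.+1 = j'.+1 %[mod b]
  by apply/eqP; rewrite -(addn1 j) -(addn1 j') eqn_modDr; apply/eqP.
by rewrite (chart_cong cv ei ej1).
Qed.

Lemma vedge_cong v a b i j i' j' : chart v a b ->
  i = i' %[mod a] -> j = j' %[mod b] -> vedge v i j = vedge v i' j'.
Proof.
move=> cv ei ej; rewrite /vedge (chart_cong cv ei ej).
have ei1 : i.+1 = i'.+1 %[mod a]
  by apply/eqP; rewrite -(addn1 i) -(addn1 i') eqn_modDr; apply/eqP.
by rewrite (chart_cong cv ei1 ej).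
Qed.

(** The edge e occupies row 0, or rows 0 and 1, and f stays clear of both rows:
    the two cycles can then be separated by rows. *)
Definition normal_pair v a e f : Prop :=
  (e = hedge v 0 0 \/ e = vedge v 0 0) /\
  ((exists i j, 2 <= i < a /\ f = hedge v i j) \/
   (exists i j, [/\ 2 <= i, i.+1 < a & f = vedge v i j])).

(** Exchanging the two directions makes e horizontal, and a translation brings it
    to the origin. *)
Lemma chart_at_edge v a b e f : chart v a b -> chart_edge v e -> chart_edge v f ->
  exists a' b' v', [/\ chart v' a' b', e = hedge v' 0 0 & chart_edge v' f].
Proof.
wlog [i [j ->]] : v a b / exists i j, e = hedge v i j.
  move=> W cv [eh|[i [j ev]]] ef; first by apply: (W v a b) => //; left.
  apply: (W _ b a _ (chart_swap cv)); first by exists j, i.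
    by left; exists j, i.
  by case: ef => -[i' [j' ->]]; [right|left]; exists j', i'.
move=> cv _ fv; exists a, b, (fun x y => v (x + i) (y + j)).
split=> //; first exact: chart_shift.
have [a3 b3] := chart_gt3 cv.
(* Adding a.-1 * i amounts to subtracting i modulo a. *)
have rowE i' : i' + a.-1 * i + i = i' %[mod a].
  have -> : i' + a.-1 * i + i = i * a + i' by nia.
  by rewrite modnMDl.
have colE j' : j' + b.-1 * j + j = j' %[mod b].
  have -> : j' + b.-1 * j + j = j * b + j' by nia.
  by rewrite modnMDl.
case: fv => -[i' [j' ->]]; [left|right];
  exists (i' + a.-1 * i), (j' + b.-1 * j).
  by rewrite (hedge_cong (i' := i' + a.-1 * i + i) (j' := j' + b.-1 * j + j) cv) //.
by rewrite (vedge_cong (i' := i' + a.-1 * i + i) (j' := j' + b.-1 * j + j) cv) //.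
Qed.

(** Put e horizontally at the origin.  If f avoids row 0, then a reflection of the
    rows, if needed, moves f off row 1 as well.  If f meets row 0, then, being
    independent of e, it avoids columns 0 and 1, and exchanging the two directions
    turns these columns into rows. *)
Lemma normalize_pair v0 a0 b0 e f : chart v0 a0 b0 -> chart_edge v0 e ->
    chart_edge v0 f -> e :&: f = set0 ->
  exists a b v, chart v a b /\ normal_pair v a e f.
Proof.
move=> cv0 ee0 fe0 dis.
have [a [b [v [cv eE fe]]]] := chart_at_edge cv0 ee0 fe0.
have [a3 b3] := chart_gt3 cv.
have nin x : x \in e -> x \notin f.
  by move=> xe; apply/negP => xf; move/setP/(_ x): dis; rewrite !inE xe xf.
have n0 : v 0 0 \notin f by apply: nin; rewrite eE set21.
have n1 : v 0 1 \notin f by apply: nin; rewrite eE set22.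
have rp j : v a j = v 0 j by rewrite -(chart_rper cv 0) add0n.
have cr := @chart_reflect v a b a cv.
have e' : e = hedge (reflect_rows v a a) 0 0.
  by rewrite eE /hedge !(reflect_rowsE _ cv) // subn0 !rp.
have amod i : i %% a < a by rewrite ltn_mod; lia.
have bmod j : j %% b < b by rewrite ltn_mod; lia.
case: fe => [[i0 [j0 fE]]|[i0 [j0 fE]]];
  [rewrite -(hedge_cong cv (modn_mod i0 a) (modn_mod j0 b)) in fE
  |rewrite -(vedge_cong cv (modn_mod i0 a) (modn_mod j0 b)) in fE];
  move: (i0 %% a) (j0 %% b) (amod i0) (bmod j0) fE => i j ia jb fE; subst f.
- have [i_0|[i_1|i2]] : i = 0 \/ i = 1 \/ 2 <= i by lia.
  + subst i; exists b, a, (fun i j => v j i); split; first exact: chart_swap.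
    split; first by right.
    right; exists j, 0; split=> //.
      have : j != 0 by apply: contraNneq n0 => ->; rewrite set21.
      have : j != 1 by apply: contraNneq n1 => ->; rewrite set21.
      by lia.
    rewrite ltn_neqAle jb andbT; apply: contraNneq n0 => jE.
    by rewrite -(chart_cper cv) add0n -jE set22.
  + subst i; exists a, b, (reflect_rows v a a); split=> //; split; first by left.
    left; exists (a - 1), j; split; first by lia.
    by apply: hedge_reflect cv _; lia.
  + exists a, b, v; split=> //; split; first by left.
    by left; exists i, j; split=> //; lia.
- have [iE|[i_1|i2]] :
    (i = 0 \/ i.+1 = a) \/ (i = 1 \/ (2 <= i /\ i.+1 < a)) by lia.
  + exists b, a, (fun i j => v j i); split; first exact: chart_swap.
    split; first by right.
    left; exists j, i; split=> //; rewrite jb andbT.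
    have vin : v 0 j \in vedge v i j.
      by case: iE => [->|E]; rewrite ?set21 // -rp -E set22.
    have : j != 0 by apply: contraNneq n0 => jE; rewrite {1}jE in vin.
    have : j != 1 by apply: contraNneq n1 => jE; rewrite {1}jE in vin.
    by lia.
  + subst i; exists a, b, (reflect_rows v a a); split=> //; split; first by left.
    right; exists (a - 2), j; split; [lia|lia|].
    by apply: vedge_reflect cv _; lia.
  + exists a, b, v; split=> //; split; first by left.
    by case: i2 => ? ?; right; exists i, j.
Qed.

Lemma chart_cylinder v a b k m : chart v a b -> m <= a ->
  cylinder (fun i => v (k + i)) m b.
Proof.
case=> [[_ b3] [_ eb] _ rp cp ha va inj] ma; split=> //.
- by move=> i j _; rewrite addnS.
- move=> i j i' j' im i'm /inj[/eqP + ->]; rewrite eqn_modDl => /eqP E.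
  by rewrite !modn_small in E; lia.
Qed.

Lemma chart_cylinder_up v a b h : chart v a b -> h < a ->
  cylinder (fun i => v (h - i)) h.+1 b.
Proof.
case=> [[_ b3] [_ eb] _ rp cp ha va inj] ma; split=> //.
- by move=> i j im; rewrite -(subnSK (n := h)) // adj_sym.
- move=> i j i' j' im i'm /inj[E ->].
  by rewrite !modn_small in E; lia.
Qed.

(** * Disjoint cycle covers of a torus *)

Definition dcc_through e f l : Prop := exists J1 J2 : seq H,
  [/\ two_dcc J1 J2, cycle_length J1 = l, cycle_length J2 = #|H| - l,
      e \in cycle_edges J1 & f \in cycle_edges J2].

(** Disjointness and the right total length already force the two cycles to cover
    all vertices. *)
Lemma dcc_of_disjoint e f (J1 J2 : seq H) : is_cycle J1 -> is_cycle J2 ->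
    {in J1, forall x, x \notin J2} -> size J1 + size J2 = #|H| ->
    e \in cycle_edges J1 -> f \in cycle_edges J2 ->
  dcc_through e f (size J1).
Proof.
move=> c1 c2 dis sz e1 f2; exists J1, J2; rewrite !cycle_lengthE //.
split=> //; last by rewrite -sz addKn.
have I0 : cycle_vertices J1 :&: cycle_vertices J2 = set0.
  apply/setP=> x; rewrite !inE; apply/negP => /andP[/dis] + x2.
  by rewrite x2.
split=> //; apply/eqP; rewrite eqEcard subsetT cardsT /= -sz.
have [[_ /andP[_ u1]] [_ /andP[_ u2]]] := (c1, c2).
rewrite cardsU I0 cards0 subn0 /cycle_vertices.
by rewrite !cardsE (card_uniqP u1) (card_uniqP u2).
Qed.

(** The columns 0 to t - 1 of rows 0 and 1 bound the first cycle.  The other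
    columns of these rows bound a second ladder, which is spliced at column t with
    a Hamiltonian cycle of the rows from 2 on; this costs one horizontal edge of
    row 2, whence the hypothesis on f. *)
Lemma ladder_dcc v a b e f t : chart v a b ->
    e = hedge v 0 0 \/ e = hedge v 1 0 \/ e = vedge v 0 0 ->
    grid_edge (fun i => v (2 + i)) (a - 2) f -> (forall j, f <> hedge v 2 j) ->
    2 <= t -> t.*2 <= b ->
  dcc_through e f t.*2.
Proof.
move=> cv ee ff nf t2 tb; have [a3 b3] := chart_gt3 cv.
have [ea eb] := chart_even cv.
have c01 : cylinder v 2 b by apply: (chart_cylinder 0 cv); lia.
have aE : a - 2 = (a - 3).+1 by lia.
have c2 : cylinder (fun i => v (2 + i)) (a - 3).+1 b.
  by apply: (chart_cylinder 2 cv); lia.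
have [|J1 [cJ1 sJ1 xJ1 [h0 h1 v0]]] := ladder_cycle (n := t) 0 c01.
  by lia.
have [|K [cK sK xK [_ k1 _]]] := ladder_cycle (n := b - t) t c01.
  by lia.
rewrite aE in ff.
have [L [cL sL xL fL eL]] := full_rows_cycle (odd t) c2 ff.
have vinj i j i' j' : i < a -> i' < a -> j < b -> j' < b -> v i j = v i' j' ->
    i = i' /\ j = j'.
  by move=> im i'm jm j'm /(chart_inj cv)[]; rewrite !modn_small.
have rowinj i j i' j' : i < a -> i' < a -> v i j = v i' j' -> i = i'.
  by move=> im i'm /(chart_inj cv)[+ _]; rewrite !modn_small.
have disKL : [disjoint K & L].
  rewrite disjoint_has; apply/hasPn => x /xK[i [j [i2 _ ->]]]; apply/negP.
  by move=> /xL[i' [j' [i'2 /rowinj]]]; lia.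
have k2 : hedge v 2 t \in cycle_edges L by apply: eL.
have [J2 [cJ2 pJ2 _ eJ2 _]] := cycle_splice cK cL disKL k1 k2
  (chart_vadj cv 1 _) (chart_vadj cv 1 _).
rewrite -sJ1; apply: dcc_of_disjoint cJ1 cJ2 _ _ _ _.
- move=> x /xJ1[i [j [i2 jt ->]]]; rewrite (perm_mem pJ2) mem_cat.
  apply/negP => /orP[/xK[i' [j' [i'2 j't /vinj]]]|/xL[i' [j' [i'2 /rowinj]]]]; lia.
- by rewrite (perm_size pJ2) size_cat sJ1 sK sL (chart_card cv); nia.
- by case: ee => [->|[->|->]].
- by apply: eJ2 => //; apply/eqP; apply: nf.
Qed.

(** When f is a horizontal edge of row 2, exchanging rows 0 and 1 by a reflection
    moves f to row a - 1, which differs from row 2. *)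
Lemma normal_dcc_small v a b e f t : chart v a b -> normal_pair v a e f ->
  2 <= t -> t.*2 <= b -> dcc_through e f t.*2.
Proof.
move=> cv [ee ff] t2 tb; have [a3 b3] := chart_gt3 cv.
have gf : grid_edge (fun i => v (2 + i)) (a - 2) f.
  case: ff => [[i [j [ia ->]]]|[i [j [i2 ia ->]]]]; [left|right];
    exists (i - 2), j; split; try lia; rewrite /hedge /vedge /=.
    by rewrite subnKC //; lia.
  by rewrite addnS subnKC.
have [[j fE]|nf] : (exists j, f = hedge v 2 j) \/ (forall j, f <> hedge v 2 j).
- case: ff => [[i [j [ia ->]]]|[i [j [i2 ia ->]]]].
    have [->|/eqP n2] := eqVneq i 2; first by left; exists j.
    right=> j' /set2_inj [] [/(chart_inj cv)[+ _] _]; rewrite !modn_small; lia.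
  right=> j' /set2_inj [] [/(chart_inj cv)[+ _] /(chart_inj cv)[+ _]];
    rewrite !modn_small; lia.
- have cr := @chart_reflect v a b a.+1 cv.
  apply: (ladder_dcc cr) => //.
  + have rp j' : v a j' = v 0 j' by rewrite -(chart_rper cv 0).
    have rp1 j' : v a.+1 j' = v 1 j' by rewrite -(chart_rper cv 1).
    case: ee => ->; right; [left|right].
      have -> : hedge v 0 0 = hedge v a 0 by rewrite /hedge !rp.
      by rewrite (hedge_reflect (c := a.+1) _ cv) // subSnn.
    have -> : vedge v 0 0 = vedge v a 0 by rewrite /vedge rp rp1.
    by rewrite (vedge_reflect (c := a.+1) _ cv) // subnn.
  + left; exists (a - 3), j; split; first by lia.
    rewrite fE (hedge_reflect (c := a.+1) _ cv) /hedge; last by lia.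
    by have -> : a.+1 - 2 = 2 + (a - 3) by lia.
  + move=> j'; rewrite fE (hedge_reflect (c := a.+1) _ cv); last by lia.
    by move=> /set2_inj [] [/(chart_inj cr)[+ _] _]; rewrite !modn_small; lia.
- apply: (ladder_dcc cv) => //; case: ee; auto.
Qed.

Lemma rows_dcc v a b h e f : chart v a b -> 0 < h < a ->
  grid_edge v h e -> grid_edge (fun i => v (h + i)) (a - h) f ->
  dcc_through e f (h * b).
Proof.
move=> cv ha ee ff.
have hE : h = h.-1.+1 by lia.
have aE : a - h = (a - h).-1.+1 by lia.
have c1 : cylinder v h b by apply: (chart_cylinder 0 cv); lia.
have c2 : cylinder (fun i => v (h + i)) (a - h) b.
  by apply: (chart_cylinder h cv); lia.
rewrite hE in ee c1; rewrite aE in ff c2.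
have [J1 [cJ1 sJ1 xJ1 eJ1 _]] := full_rows_cycle false c1 ee.
have [J2 [cJ2 sJ2 xJ2 fJ2 _]] := full_rows_cycle false c2 ff.
have -> : h * b = size J1 by rewrite sJ1 -hE.
apply: dcc_of_disjoint cJ1 cJ2 _ _ eJ1 fJ2.
- move=> x /xJ1[i [j [ih ->]]]; apply/negP => /xJ2[i' [j' [i'h]]].
  by move=> /(chart_inj cv)[+ _]; rewrite !modn_small; lia.
- by rewrite sJ1 sJ2 -hE -aE -mulnDl subnKC ?(chart_card cv) //; lia.
Qed.

(** Row h is shared: its first r vertices hang as dominos from row h - 1, the other
    b - r vertices from row h + 1.  The side conditions ensure that no domino is
    attached to e or f, and that e, if it joins rows h - 1 and h, lies in one of
    the first r columns. *)
Lemma fringe_dcc v a b h r e f : chart v a b -> 0 < h -> h.+1 < a ->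
    ~~ odd r -> r < b ->
    (exists i j, [/\ i < h, j < b, e = hedge v i j &
       [|| i.+1 < h, odd j | r <= j]]) \/
    (exists i j, [/\ i < h, e = vedge v i j & (i.+1 < h) || (j < r)]) ->
    (exists i j, [/\ h < i < a, f = hedge v i j & (h.+1 < i) || odd j]) \/
    (exists i j, [/\ h < i, i.+1 < a & f = vedge v i j]) ->
  dcc_through e f (h * b + r).
Proof.
move=> cv h0 ha er rb ee ff; have [a3 b3] := chart_gt3 cv.
have [ea eb] := chart_even cv.
have c1 : cylinder (fun i => v (h - i)) h.-1.+2 b.
  by rewrite prednK //; apply: chart_cylinder_up cv _; lia.
have c2 : cylinder (fun i => v (h + i)) (a - h - 2).+2 b.
  by apply: (chart_cylinder h cv); lia.
set u1 := fun i => _ in c1; set u2 := fun i => _ in c2.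
have [||J1 [cJ1 sJ1 xJ1 eJ1]] := @fringed_cycle H _ u1 b 0 r./2 e c1.
- by lia.
- rewrite add0n even_halfK //.
  case: ee => [[i [j [ih jb -> hj]]]|[i [j [ih -> hj]]]]; [left|right].
    exists (h - i), j; split; [lia| |lia].
    by rewrite /u1 /hedge subKn // ltnW.
  exists (h - i.+1), j; split; [lia| |lia].
  rewrite /u1 /vedge setUC; congr [set _; _].
    by rewrite subKn.
  by rewrite subnSK // subKn // ltnW.
have [||J2 [cJ2 sJ2 xJ2 fJ2]] := @fringed_cycle H _ u2 b r./2 (b - r)./2 f c2.
- by lia.
- case: ff => [[i [j [ih -> hj]]]|[i [j [ih ia ->]]]]; [left|right].
    exists (i - h), j; split; [lia| |lia].
    by rewrite /u2 /hedge subnKC //; lia.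
  exists (i - h), j; split; [lia| |lia].
  by rewrite /u2 /vedge addnS subnKC //; lia.
have sz1 : size J1 = h * b + r by rewrite sJ1 prednK // even_halfK.
rewrite -sz1; apply: dcc_of_disjoint cJ1 cJ2 _ _ eJ1 fJ2.
- have rinj i j i' j' : v i j = v i' j' -> i < a -> i' < a ->
      i = i' /\ (j < b -> j' < b -> j = j').
    move=> /(chart_inj cv)[+ jj] im i'm; rewrite !modn_small // => ->.
    by split=> // jb j'b; rewrite !modn_small in jj.
  move=> x x1; apply/negP => x2; move: x1 x2.
  move=> /xJ1[[i [j [im ->]]]|[j [jm ->]]] /xJ2[[i' [j' [i'm E]]]|[j' [j'm E]]];
    have [] := rinj _ _ _ _ E; lia.
- by rewrite sz1 sJ2 (chart_card cv); nia.
Qed.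

(** The first cycle meets w = h + (0 < r) <= a/2 consecutive rows.  Translating the
    rows by s = w - i, where i >= 2 is the first row met by f, keeps e among the
    first w rows and f among the others.  If r > 0, the columns are translated as
    well: the column of f becomes odd, so that no domino is attached
    to f; that of e becomes b - 2 or b - 1 if e is horizontal, where no domino
    of the first cycle is attached to it (r <= b - 2), and 0 or 1 if e is
    vertical (r >= 2). *)
Lemma normal_dcc_large v a b e f l : chart v a b -> normal_pair v a e f ->
  ~~ odd l -> b < l <= (a * b)./2 -> dcc_through e f l.
Proof.
move=> cv [ee ff] ol bl; have [a3 b3] := chart_gt3 cv.
have [ea eb] := chart_even cv.
set h := l %/ b; set r := l %% b.
have lE : l = h * b + r by exact: divn_eq.
have rb : r < b by rewrite ltn_mod; lia.
have er : ~~ odd r by rewrite /r (odd_mod _ (negbTE eb)).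
have ab2 : (a * b)./2 = a./2 * b by nia.
have h0 : 0 < h by rewrite /h divn_gt0; lia.
have w2 : 2 <= h + (0 < r).
  case: (posnP r) => r0; last by lia.
  nia.
have wa : h + (0 < r) <= a./2.
  by case: (posnP r) => r0; nia.
set w := h + (0 < r) in w2 wa.
have [i [j [fi fE]]] : exists i j, 2 <= i < a /\
    (f = hedge v i j \/ (i.+1 < a /\ f = vedge v i j)).
  case: ff => [[i [j [ia fE]]]|[i [j [i2 ia fE]]]]; exists i, j; first by auto.
  by split; [lia|right].
set s := w - i.
have [c [cb oc ec]] : exists c, [/\ c < b, odd (j + c) &
    (e = hedge v 0 0 /\ b.-2 <= c) \/ (e = vedge v 0 0 /\ c <= 1)].
  case: ee => eE.
    exists (if odd j then b.-2 else b.-1).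
    by split; [| |left; split=> //]; case: ifP; lia.
  by exists (~~ odd j : nat); split; [| |right; split=> //]; lia.
(* The translation sending row 0 to row s and column 0 to column c. *)
pose v' x y := v (x + (a - s)) (y + (b - c)).
have cv' : chart v' a b by apply: chart_shift.
have sa : s < a by lia.
have modr x : x + s + (a - s) = x %[mod a] by rewrite -addnA subnKC ?modnDr // ltnW.
have modc x : x + c + (b - c) = x %[mod b] by rewrite -addnA subnKC ?modnDr // ltnW.
have hE x y : hedge v x y = hedge v' (x + s) (y + c).
  rewrite -(hedge_cong cv (modr x) (modc y)) /hedge /v'.
  by rewrite [(_ + c).+1 + _]addSn.
have vE x y : vedge v x y = vedge v' (x + s) (y + c).
  rewrite -(vedge_cong cv (modr x) (modc y)) /vedge /v'.
  by rewrite [(_ + s).+1 + _]addSn.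
have {}ec : (e = hedge v' s c /\ b.-2 <= c) \/ (e = vedge v' s c /\ c <= 1).
  by move: ec; rewrite hE vE !add0n.
have {}fE : f = hedge v' (i + s) (j + c) \/
    (i.+1 < a /\ f = vedge v' (i + s) (j + c)).
  by move: fE; rewrite hE vE.
have [wE sE] : w = h + (0 < r) /\ s = w - i by [].
rewrite lE; have [r0|r0] := posnP r.
- rewrite r0 addn0; apply: (rows_dcc cv'); first by lia.
    by case: ec => -[-> _]; [left|right]; exists s, c; split=> //; lia.
  case: fE => [->|[ia ->]]; [left|right];
    exists (i + s - h), (j + c); split; try lia.
    by rewrite /hedge subnKC //; lia.
  by rewrite /vedge addnS subnKC //; lia.
apply: (fringe_dcc cv') => //; try lia.
- case: ec => -[-> hc]; [left|right]; exists s, c; split=> //; lia.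
- case: fE => [->|[ia ->]]; [left|right]; exists (i + s), (j + c); split=> //; lia.
Qed.

Theorem torus_dcc v a b e f l : chart v a b -> chart_edge v e ->
  chart_edge v f -> e :&: f = set0 -> ~~ odd l -> 4 <= l <= #|H|./2 ->
  dcc_through e f l.
Proof.
move=> cv ee ff dis ol; rewrite (chart_card cv) => lb.
have [a' [b' [v' [cv' np]]]] := normalize_pair cv ee ff dis.
have abE : a' * b' = a * b by rewrite -(chart_card cv') (chart_card cv).
have [lb'|bl] := leqP l b'.
  have -> : l = l./2.*2 by rewrite even_halfK.
  by apply: normal_dcc_small cv' np _ _; lia.
by apply: normal_dcc_large cv' np ol _; rewrite abE; lia.
Qed.
End Torus.

(** * Folding a Cartesian product into a torus *)

Section Circuits.
Variable F : sgraph.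

(** A Hamiltonian cycle as a periodic map, the one-dimensional analogue of a chart.
    Period 2 is allowed, so that K_2 has one too and both kinds of factors of
    a cube are treated alike. *)
Record circuit (u : nat -> F) (p : nat) : Prop := Circuit {
  circuit_gt0 : 0 < p;
  circuit_card : #|F| = p;
  circuit_per : forall i, u (i + p) = u i;
  circuit_adj : forall i, adj (u i) (u i.+1);
  circuit_inj : forall i j, u i = u j -> i = j %[mod p] }.

Definition circuit_edge (u : nat -> F) x y : Prop :=
  exists i, [set x; y] = [set u i; u i.+1].

Lemma circuit_surj u p x : circuit u p -> exists i, u i = x.
Proof.
case=> p0 card per adj inj.
have injf : injective (fun i : 'I_p => u i).
  by move=> i j /inj; rewrite !modn_small // => /val_inj.
have le : #|F| <= #|'I_p| by rewrite card_ord card.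
by have /codomP[i ->] := inj_card_onto injf le x; exists i.
Qed.

Lemma circuit_shift u p s : circuit u p -> circuit (fun i => u (s + i)) p.
Proof.
case=> p0 card per adj inj; split=> //.
- by move=> i; rewrite addnA per.
- by move=> i; rewrite addnS.
- by move=> i j /inj /eqP; rewrite eqn_modDl => /eqP.
Qed.

Lemma circuit_mod u p i : circuit u p -> u (i %% p) = u i.
Proof.
move=> ru; have E k s : u (s + k * p) = u s.
  by elim: k => [|k IH]; rewrite ?addn0 // mulSnr addnA (circuit_per ru).
by rewrite [in RHS](divn_eq i p) addnC E.
Qed.

Lemma circuit_of_cycle c x0 : is_cycle c -> size c = #|F| ->
  circuit (fun i => nth x0 c (i %% size c)) (size c) /\
  forall x y, [set x; y] \in cycle_edges c ->
    circuit_edge (fun i => nth x0 c (i %% size c)) x y.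
Proof.
move=> cc sc; have [s2 /andP[cyc uc]] := cc; set f := fun i => _.
have s0 : 0 < size c by lia.
have nextE i : next c (f i) = f i.+1.
  have fi : f i \in c by rewrite mem_nth ?ltn_mod.
  rewrite /f -[in RHS]addn1 -modnDml addn1.
  have im := ltn_pmod i s0; move: (i %% size c) im => k kc.
  rewrite next_nth mem_nth // index_uniq //.
  (* At the last position, next falls back to its default value, the head. *)
  case: (c) uc s0 kc => // z p _ _ /=; rewrite ltnS leq_eqVlt => /orP[/eqP->|kp].
    by rewrite modnn nth_default.
  by rewrite modn_small //= (set_nth_default x0).
split; last first.
  move=> x y /imsetP[z zc E]; exists (index z c); rewrite E.
  by rewrite -nextE /f modn_small ?index_mem // nth_index.
split=> //.
- by move=> i; rewrite /f modnDr.
- by move=> i; rewrite -nextE; apply: (next_cycle cyc); rewrite mem_nth ?ltn_mod.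
- by move=> i j /eqP; rewrite /f nth_uniq ?ltn_mod // => /eqP.
Qed.
End Circuits.

Lemma cycle_circuit k : 2 < k -> exists2 u : nat -> cycle_graph k,
  circuit u k & (forall i, u i = i %% k :> nat) /\
    forall x y, adj x y -> circuit_edge u x y.
Proof.
case: k => // k k2; pose u i : cycle_graph k.+1 := Ordinal (ltn_pmod i (ltn0Sn k)).
have ordSE i : ordS (u i) = u i.+1.
  by apply: val_inj; rewrite /= -addn1 modnDml addn1.
have uE (x : 'I_k.+1) : u x = x by apply: val_inj; rewrite /= modn_small.
have nu i : u i != u i.+1.
  apply/eqP => /(congr1 val)/= /eqP.
  by rewrite -{1}[i]addn0 -(addn1 i) eqn_modDl mod0n modn_small //; lia.
exists u; split=> //.
- by rewrite card_ord.
- by move=> i; apply: val_inj; rewrite /= modnDr.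
- by move=> i; rewrite /adj /= /cycle_rel ordSE eqxx nu.
- by move=> i j [].
- move=> x y /andP[_ /orP[/eqP->|/eqP->]].
    by exists x; rewrite -ordSE uE.
  by exists y; rewrite -ordSE uE setUC.
Qed.

Lemma K2_circuit : exists2 u : nat -> complete_graph 2,
  circuit u 2 & forall x y, adj x y -> circuit_edge u x y.
Proof.
pose u i : complete_graph 2 := Ordinal (ltn_pmod i (ltn0Sn 1)).
exists u; first split=> //.
- by rewrite card_ord.
- by move=> i; apply: val_inj; rewrite /= modnDr.
- by move=> i; rewrite /adj /= /complete_rel; apply/eqP => -[];
  rewrite !modn2 /=; lia.
- by move=> i j [].
- move=> [[|[|x]] hx] [[|[|y]] hy] // _; exists 0; [|rewrite setUC];
  congr [set _; _]; exact: val_inj.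
Qed.

Lemma factor_circuit k : 1 < k -> exists2 u : nat -> hypercube_factor k,
  circuit u k & forall x y, adj x y -> circuit_edge u x y.
Proof.
rewrite /hypercube_factor; have [->|] := eqVneq k 2.
  by move=> _; exact: K2_circuit.
move=> k2 k1; have [|u ru [_ eu]] := @cycle_circuit k; first by lia.
by exists u.
Qed.

Lemma adj_tail (A B : sgraph) (x : A) (y y' : B) :
  adj y y' -> @adj (cart_prod A B) (x, y) (x, y').
Proof. by move=> yy'; rewrite /adj /cart_prod /cart_rel eqxx yy'. Qed.

Lemma adj_head (A B : sgraph) (x x' : A) (y : B) :
  adj x x' -> @adj (cart_prod A B) (x, y) (x', y).
Proof. by move=> xx'; rewrite /adj /cart_prod /cart_rel eqxx xx' orbT. Qed.

Section Product.
Variables (F G : sgraph).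
Variables (x : nat -> F) (y : nat -> G) (p b : nat).
Hypotheses (rx : circuit x p) (ex : forall s t, adj s t -> circuit_edge x s t).
Hypotheses (ry : circuit y b) (ey : forall s t, adj s t -> circuit_edge y s t).

Lemma product_chart : 3 < p -> 3 < b -> ~~ odd p -> ~~ odd b ->
  exists v, chart v p b /\
   forall s t : cart_prod F G, adj s t -> chart_edge v [set s; t].
Proof.
move=> p3 b3 op ob; exists (fun i j => (x i, y j)); split.
  split=> //.
  - by rewrite card_prod (circuit_card rx) (circuit_card ry).
  - by move=> i j; rewrite (circuit_per rx).
  - by move=> i j; rewrite (circuit_per ry).
  - by move=> i j; rewrite /adj /= /cart_rel /= eqxx (circuit_adj ry).
  - by move=> i j; rewrite /adj /= /cart_rel /= eqxx (circuit_adj rx) orbT.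
  - by move=> i j i' j' [/(circuit_inj rx) ? /(circuit_inj ry)].
move=> [s1 s2] [t1 t2] /orP[] /= /andP[/eqP /= -> ].
  move=> /ey[j E]; have [i <-] := circuit_surj t1 rx; left; exists i, j.
  by case: (set2_inj E) => -[-> ->] //; rewrite setUC.
move=> /ex[i E]; have [j <-] := circuit_surj t2 ry; right; exists i, j.
by case: (set2_inj E) => -[-> ->] //; rewrite setUC.
Qed.

(** The rows are copies of the second factor; starting them at a suitable point of
    the first circuit, any edge of the product becomes an edge of the resulting
    cylinder of p rows, and full_rows_cycle applies. *)
Lemma product_circuit s t : 1 < p -> 3 < b -> ~~ odd b ->
  @adj (cart_prod F G) s t ->
  exists2 c : nat -> cart_prod F G, circuit c (p * b) & circuit_edge c s t.
Proof.
move=> p1 b3 ob st.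
have cyl k : cylinder (fun i j => (x (k + i), y j) : cart_prod F G) p b.
  have rk := circuit_shift k rx; split=> //.
  - by move=> i j _; rewrite (circuit_per ry).
  - by move=> i j _; rewrite /adj /= /cart_rel /= eqxx (circuit_adj ry).
  - by move=> i j _; rewrite /adj /= /cart_rel /= eqxx (circuit_adj rk) orbT.
  - move=> i j i' j' im i'm [/(circuit_inj rk) E /(circuit_inj ry) ->].
    by rewrite !modn_small in E.
have [k ge] : exists k,
    grid_edge (fun i j => (x (k + i), y j) : cart_prod F G) p [set s; t].
  case: s t st => [s1 s2] [t1 t2] /orP[] /= /andP[/eqP /= -> ].
    move=> /ey[j E]; have [i <-] := circuit_surj t1 rx; exists i; left; exists 0, j.
    split; first exact: ltnW.
    by rewrite /hedge addn0; case: (set2_inj E) => -[-> ->] //; rewrite setUC.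
  move=> /ex[i E]; have [j <-] := circuit_surj t2 ry; exists i; right; exists 0, j.
  split=> //.
  by rewrite /vedge addn0 addn1; case: (set2_inj E) => -[-> ->] //; rewrite setUC.
have := cyl k; rewrite -(prednK (circuit_gt0 rx)) in ge * => cy.
have [c [cc sc _ st_c _]] := full_rows_cycle false cy ge.
rewrite prednK ?(circuit_gt0 rx) // in sc.
have [|rc /(_ _ _ st_c) re] := circuit_of_cycle s cc.
  by rewrite sc card_prod (circuit_card rx) (circuit_card ry).
exists (fun i => nth s c (i %% size c)) => //.
by rewrite prednK ?(circuit_gt0 rx) // -sc.
Qed.
End Product.

Definition torus_pair (H : sgraph) (e f : {set H}) : Prop :=
  exists a b v, [/\ chart v a b, chart_edge v e & chart_edge v f].

Lemma torus_pairC (H : sgraph) (e f : {set H}) : torus_pair e f -> torus_pair f e.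
Proof. by move=> [a [b [v [cv ee ef]]]]; exists a, b, v. Qed.

(** Equal cardinalities make s a bijection, so that the image under s of a spanning
    torus is again spanning. *)
Lemma torus_pair_iso (H H' : sgraph) (s : H -> H') (x y z t : H) :
  injective s -> #|H| = #|H'| -> (forall p q, adj p q -> adj (s p) (s q)) ->
  torus_pair [set x; y] [set z; t] -> torus_pair [set s x; s y] [set s z; s t].
Proof.
move=> sI card sadj [a [b [v [cv ee ef]]]].
exists a, b, (fun i j => s (v i j)); split.
- case: cv => g3 ev crd rp cp ha va inj.
  apply: (Chart g3 ev) => [|i j|i j|i j|i j|i j i' j' /sI /inj //].
  + by rewrite -card.
  + by rewrite rp.
  + by rewrite cp.
  + exact/sadj/ha.
  + exact/sadj/va.
- case: ee => -[i [j E]]; [left|right]; exists i, j;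
  by case: (set2_inj E) => -[-> ->] //; rewrite setUC.
- case: ef => -[i [j E]]; [left|right]; exists i, j;
  by case: (set2_inj E) => -[-> ->] //; rewrite setUC.
Qed.

Section Fold.
Variables (F H : sgraph) (x : nat -> F) (p : nat).
Hypotheses (rx : circuit x p) (ex : forall s t, adj s t -> circuit_edge x s t).
Hypotheses (p1 : 1 < p) (op : ~~ odd p).

(** A Hamiltonian cycle c of F x C_b replaces, in F x (C_a x C_b), the two
    directions F and C_b by the single direction of length p b. *)
Lemma fold_chart v a b (c : nat -> cart_prod F (cycle_graph b)) :
  chart v a b -> circuit c (p * b) ->
  chart (fun i j => ((c j).1, v i (c j).2) : cart_prod F H) a (p * b).
Proof.
move=> cv rc; have [a3 b3] := chart_gt3 cv; have [ea eb] := chart_even cv.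
split.
- by split=> //; nia.
- by rewrite oddM negb_and op.
- by rewrite card_prod (circuit_card rx) (chart_card cv) mulnCA.
- by move=> i j; rewrite (chart_rper cv).
- by move=> i j; rewrite (circuit_per rc).
- move=> i j; have := circuit_adj rc j; case: (c j) (c j.+1) => [x1 y1] [x2 y2].
  rewrite /adj /= /cart_rel /= => /orP[/andP[-> +]|/andP[/eqP-> ->]]; last first.
    by rewrite eqxx orbT.
  have vS (w z : 'I_b) : z == ordS w -> adj (v i w) (v i z).
    move=> /eqP -> /=.
    have -> : v i (w.+1 %% b) = v i w.+1.
      by apply: (chart_cong cv); rewrite ?modn_mod.
    exact: (chart_hadj cv).
  by move=> /andP[_ /orP[/vS->|/vS]] //; rewrite adj_sym => ->.
- by move=> i j; rewrite /adj /= /cart_rel /= eqxx (chart_vadj cv).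
- move=> i j i' j' [E1 /(chart_inj cv)[-> E2]]; split=> //.
  apply: (circuit_inj rc); case: (c j) (c j') E1 E2 => [x1 y1] [x2 y2] /= ->.
  by rewrite !modn_small // => /val_inj ->.
Qed.

Lemma chart_surj v a b y : @chart H v a b -> exists i j, v i j = y.
Proof.
move=> cv; have injv : injective (fun ij : 'I_a * 'I_b => v ij.1 ij.2).
  move=> [i j] [i' j'] /= /(chart_inj cv)[]; rewrite !modn_small //.
  by move=> /val_inj -> /val_inj ->.
have le : #|H| <= #|{: 'I_a * 'I_b}|.
  by rewrite card_prod !card_ord (chart_card cv).
by have /codomP[[i j] ->] := inj_card_onto injv le y; exists i, j.
Qed.

(** Folding keeps all edges in the direction of C_a, which takes care of the first
    edge.  The second edge either is also of this kind, or projects to an edge of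
    F x C_b, and then c is chosen through that projection. *)
Lemma fold_pair v a b i j x0 (s t : cart_prod F H) : chart v a b ->
    adj s t -> (s.1 = t.1 -> chart_edge v [set s.2; t.2]) ->
  torus_pair [set ((x0, v i j) : cart_prod F H); (x0, v i.+1 j)] [set s; t].
Proof.
move=> cv st ste; have [a3 b3] := chart_gt3 cv; have [ea eb] := chart_even cv.
have [|y ry [yE ey]] := @cycle_circuit b; first by lia.
have vyE i' j' : v i' (y j') = v i' j'.
  by apply: (chart_cong cv); rewrite // yE modn_mod.
have vert (c : nat -> cart_prod F (cycle_graph b)) i' j' z :
  circuit c (p * b) -> chart_edge
    (fun i j => ((c j).1, v i (c j).2) : cart_prod F H)
    [set (z, v i' j'); (z, v i'.+1 j')].
  move=> rc.
  have [m mE] := circuit_surj ((z, y j') : cart_prod F (cycle_graph b)) rc.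
  by right; exists i', m; rewrite /vedge mE /= !vyE.
have build (s' t' : cart_prod F (cycle_graph b)) : adj s' t' ->
   (forall c : nat -> cart_prod F (cycle_graph b),
     circuit c (p * b) -> circuit_edge c s' t' -> chart_edge
     (fun i j => ((c j).1, v i (c j).2) : cart_prod F H) [set s; t]) ->
   torus_pair [set ((x0, v i j) : cart_prod F H); (x0, v i.+1 j)] [set s; t].
  move=> st' E; have [c rc cst] := product_circuit rx ex ry ey p1 b3 eb st'.
  exists a, (p * b), (fun i j => ((c j).1, v i (c j).2) : cart_prod F H).
  by split; [exact: fold_chart | exact: vert | exact: E].
have lift i' (s' t' : cart_prod F (cycle_graph b)) : adj s' t' ->
    [set s; t] = [set (s'.1, v i' s'.2); (t'.1, v i' t'.2)] ->
   torus_pair [set ((x0, v i j) : cart_prod F H); (x0, v i.+1 j)] [set s; t].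
  move=> st' E; apply: (build _ _ st') => c _ [m mE].
  left; exists i', m; rewrite E /hedge.
  by case: (set2_inj mE) => -[<- <-] //; rewrite setUC.
case: s t st ste lift build => [s1 s2] [t1 t2] /= st ste lift build.
case/orP: st => /andP[/eqP /= E st].
  subst t1; case: ste => // -[i' [j' E]].
    apply: (lift i' (s1, y j') (s1, y j'.+1)).
      exact/adj_tail/(circuit_adj ry).
    rewrite /= !vyE.
    by case: (set2_inj E) => -[-> ->] //; rewrite setUC.
  apply: (build (x 0, y 0) (x 1, y 0)).
    exact/adj_head/(circuit_adj rx).
  move=> c rc _; have := vert c i' j' s1 rc.
  by case: (set2_inj E) => -[-> ->] //; rewrite setUC.
subst t2; have [i' [j' E2]] := chart_surj s2 cv.
apply: (lift i' (s1, y j') (t1, y j')); last by rewrite /= !vyE E2.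
exact: adj_head.
Qed.
End Fold.

Lemma edgesP (H : sgraph) (e : {set H}) : e \in edges H ->
  exists x y, adj x y /\ e = [set x; y].
Proof. by case/imsetP=> -[x y]; rewrite inE => xy ->; exists x, y. Qed.

Lemma mem_edges (H : sgraph) (x y : H) : adj x y -> [set x; y] \in edges H.
Proof. by move=> xy; apply/imsetP; exists (x, y); rewrite ?inE. Qed.

Definition toroidal (H : sgraph) : Prop :=
  forall e f, e \in edges H -> f \in edges H -> @torus_pair H e f.

(** The edge along H can be assumed vertical in the chart of H, up to exchanging
    the two directions of the chart. *)
Lemma fold_toroidal (F H : sgraph) (x : nat -> F) p (s t z w : cart_prod F H) :
    circuit x p -> (forall s t, adj s t -> circuit_edge x s t) ->
    1 < p -> ~~ odd p -> toroidal H -> adj s t -> adj z w -> s.1 = t.1 ->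
  torus_pair [set s; t] [set z; w].
Proof.
move=> rx ex p1 op tH st zw E1.
have ad (q r : cart_prod F H) : adj q r -> q.1 = r.1 -> adj q.2 r.2.
  by move=> /orP[/andP[]//|/andP[_ +] E]; rewrite E adj_irrefl.
have [a [b [v [cv se ze]]]] : exists a b v, [/\ @chart H v a b,
    chart_edge v [set s.2; t.2] & z.1 = w.1 -> chart_edge v [set z.2; w.2]].
  have es := mem_edges (ad _ _ st E1).
  have [E2|N2] := eqVneq z.1 w.1.
    have [a [b [v []]]] := tH _ _ es (mem_edges (ad _ _ zw E2)).
    by exists a, b, v.
  have [a [b [v []]]] := tH _ _ es es; exists a, b, v; split=> //.
  by move=> E; rewrite E eqxx in N2.
wlog [i [j E]] : a b v cv se ze / exists i j, [set s.2; t.2] = vedge v i j.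
  move=> W; case: (se) => -[i [j E]].
    apply: (W b a _ (chart_swap cv)); last by exists j, i.
      by right; exists j, i.
    by move=> /ze[] [i' [j' E']]; [right|left]; exists j', i'.
  by apply: (W a b v) => //; exists i, j.
have := fold_pair rx ex p1 op i j s.1 cv zw ze.
case: s t E1 E {st ad se ze} => [s1 s2] [t1 t2] /= -> E.
by case: (set2_inj E) => -[-> ->] //; rewrite setUC.
Qed.

(** * The k-ary cubes *)

Lemma kary_cubeS k n : kary_cube k n.+2 =
  cart_prod (hypercube_factor k) (kary_cube k n.+1).
Proof. by []. Qed.

Lemma card_kary_cube k n : 1 < k -> 0 < n -> #|kary_cube k n| = k ^ n.
Proof.
move=> k1; case: n => // n _; have [u ru _] := factor_circuit k1.
elim: n => [|n IH]; first by rewrite expn1 (circuit_card ru).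
by rewrite kary_cubeS card_prod (circuit_card ru) IH -expnS.
Qed.

(** If one of the two edges does not lie along the first factor, fold_toroidal
    applies.  Otherwise the automorphism exchanging the first two factors leads back
    to that case. *)
Lemma toroidal_cubeS k n : 1 < k -> ~~ odd k ->
  toroidal (kary_cube k n.+2) -> toroidal (kary_cube k n.+3).
Proof.
move=> k1 ok tH e f /edgesP[s [t [st ->]]] /edgesP[z [w [zw ->]]].
have [u ru eu] := factor_circuit k1.
have K := fold_toroidal ru eu k1 ok tH.
case/orP: (st) => /andP[/eqP E1 adj1]; first exact: K.
case/orP: (zw) => /andP[/eqP E2 adj2].
  by apply: torus_pairC; apply: K.
pose X := kary_cube k n.+1; set Fk := hypercube_factor k in u ru eu K *.
pose sw (q : Fk * (Fk * X)) := (q.2.1, (q.1, q.2.2)).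
have swK : involutive sw by move=> [? [? ?]].
have sw_adj (q r : kary_cube k n.+3) : adj q r ->
    @adj (kary_cube k n.+3) (sw q) (sw r).
  case: q r => [x1 [y1 z1]] [x2 [y2 z2]].
  case/orP => /andP[/eqP /= ->].
    case/orP => /andP[/eqP /= -> yz].
      exact/(adj_tail (A := Fk) (B := cart_prod Fk X))/(adj_tail (A := Fk)).
    exact: (adj_head (A := Fk) (B := cart_prod Fk X)).
  move=> xx.
  exact/(adj_tail (A := Fk) (B := cart_prod Fk X))/(adj_head (A := Fk)).
have -> : [set s; t] = [set sw (sw s); sw (sw t)] by rewrite !swK.
have -> : [set z; w] = [set sw (sw z); sw (sw w)] by rewrite !swK.
apply: (torus_pair_iso (H := kary_cube k n.+3) (H' := kary_cube k n.+3)) => //.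
  exact: inv_inj swK.
apply: K; [exact: sw_adj | exact: sw_adj | by rewrite /= E1].
Qed.

Lemma toroidal_square k : 3 < k -> ~~ odd k -> toroidal (kary_cube k 2).
Proof.
move=> k3 ok; have [|u ru eu] := @factor_circuit k; first by lia.
have [v [cv ve]] := product_chart ru eu ru eu k3 k3 ok ok.
move=> e f /edgesP[s [t [st ->]]] /edgesP[z [w [zw ->]]].
by exists k, k, v; split; [|exact: ve|exact: ve].
Qed.

Lemma K2_square_circuit : exists2 g : nat -> kary_cube 2 2, circuit g 4 &
  forall x y, adj x y -> circuit_edge g x y.
Proof.
pose o0 : 'I_2 := ord0; pose o1 : 'I_2 := ord_max.
pose s : seq ('I_2 * 'I_2) := [:: (o0, o0); (o0, o1); (o1, o1); (o1, o0)].
pose c : seq (kary_cube 2 2) := s.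
have cc : is_cycle c by [].
have sc : size c = #|kary_cube 2 2| by rewrite card_kary_cube.
have [rc ec] := circuit_of_cycle ((o0, o0) : kary_cube 2 2) cc sc.
exists (fun i => nth ((o0, o0) : kary_cube 2 2) c (i %% size c)) => //.
move=> x y xy; apply: ec; apply/imsetP.
have key : all (fun x : kary_cube 2 2 => all (fun y : kary_cube 2 2 => adj x y ==>
    ((x \in c) && (next c x == y)) || ((y \in c) && (next c y == x))) c) c by [].
have inc (q : kary_cube 2 2) : q \in c.
  case: q => [[[|[|q1]] h1] [[|[|q2]] h2]] //; rewrite /c /s !inE !xpair_eqE;
  by rewrite -!val_eqE.
move/allP/(_ x (inc x))/allP/(_ y (inc y)): key; rewrite xy.
case/orP=> /andP[_ /eqP <-]; first by exists x.
by exists y => //; rewrite setUC.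
Qed.

(** Up to associativity, Q_4 is the product of two copies of Q_2 = C_4. *)
Lemma toroidal_Q4 : toroidal (kary_cube 2 4).
Proof.
have [g rg eg] := K2_square_circuit.
have [v [cv ve]] := product_chart rg eg rg eg isT isT isT isT.
pose K := hypercube_factor 2; pose Q := kary_cube 2 2.
pose as' (q : (K * K) * Q) := (q.1.1, (q.1.2, q.2)).
move=> e f /edgesP[s [t [st ->]]] /edgesP[z [w [zw ->]]].
pose sa (q : kary_cube 2 4) : cart_prod Q Q := ((q.1, q.2.1), q.2.2).
have saK : cancel sa as' by move=> [? [? ?]].
have asK : cancel as' sa by move=> [[? ?] ?].
have sa_adj (q r : kary_cube 2 4) : adj q r -> adj (sa q) (sa r).
  case: q r => [x1 [y1 z1]] [x2 [y2 z2]].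
  case/orP => /andP[/eqP /= ->].
    case/orP => /andP[/eqP /= -> yz]; first exact: (adj_tail (A := Q) (B := Q)).
    exact/(adj_head (A := Q) (B := Q))/(adj_tail (A := K) (B := K)).
  move=> xx.
  exact/(adj_head (A := Q) (B := Q))/(adj_head (A := K) (B := K)).
have as_adj (q r : cart_prod Q Q) : adj q r -> @adj (kary_cube 2 4) (as' q) (as' r).
  case: q r => [[x1 y1] z1] [[x2 y2] z2].
  case/orP => /andP[/eqP /=].
    move=> [-> ->] zz; by do 2 apply: adj_tail.
  move=> -> /orP[] /andP[/eqP /= -> xy].
    exact/adj_tail/adj_head.
  exact: adj_head.
rewrite -(saK s) -(saK t) -(saK z) -(saK w).
apply: (@torus_pair_iso (cart_prod Q Q) (kary_cube 2 4) as' _ _ _ _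
  (can_inj asK) _ as_adj).
  by rewrite !card_kary_cube // card_prod !card_kary_cube.
by exists 4, 4, v; split=> //; apply: ve; apply: sa_adj.
Qed.

Theorem toroidal_cube k n : 1 < k -> ~~ odd k -> 1 < n ->
  3 < k \/ 3 < n -> toroidal (kary_cube k n).
Proof.
move=> k1 ok n1 kn.
have [k2|k3] : k = 2 \/ 3 < k by lia.
  subst k; have -> : n = (n - 4).+4 by lia.
  elim: (n - 4) => [|m]; [exact: toroidal_Q4|exact: toroidal_cubeS].
have -> : n = (n - 2).+2 by lia.
elim: (n - 2) => [|m]; [exact: toroidal_square|exact: toroidal_cubeS].
Qed.

Lemma bipartite_cube k n : 1 < k -> ~~ odd k -> 0 < n -> bipartite (kary_cube k n).
Proof.
move=> k1 ok; have bF : bipartite (hypercube_factor k).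
  have [u ru eu] := factor_circuit k1.
  exists [set x | [exists i : 'I_k, ~~ odd i && (u i == x)]] => x y /eu [i E].
  have mE j :
      (u j \in [set x | [exists i : 'I_k, ~~ odd i && (u i == x)]]) = ~~ odd j.
    rewrite inE -(odd_mod j (negbTE ok));
    apply/existsP/idP => [[l /andP[ol /eqP]]|oj].
      by move/(circuit_inj ru) => <-; rewrite (odd_mod _ (negbTE ok)).
    exists (Ordinal (ltn_pmod j (ltnW k1))); rewrite oj /=.
    by rewrite (circuit_mod _ ru).
  by case: (set2_inj E) => -[-> ->]; rewrite !mE /=; case: (odd i).
case: n => // n _; elim: n => // n [B bB]; have [A bA] := bF.
rewrite kary_cubeS; exists [set q | (q.1 \in A) (+) (q.2 \in B)].
move=> [x1 x2] [y1 y2]; rewrite !inE /= => /orP[] /andP[/eqP /= ->].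
  by move/bB; case: (_ \in A); case: (_ \in B); case: (_ \in B).
by move/bA; case: (_ \in B); case: (_ \in A); case: (_ \in A).
Qed.

(** Two independent edges of Q_3 lie in opposite faces, which is decided by
    enumeration. *)
Lemma Q3_faces (e f : {set kary_cube 2 3}) : e \in edges (kary_cube 2 3) ->
  f \in edges (kary_cube 2 3) -> e :&: f = set0 -> dcc_through e f 4.
Proof.
move=> /edgesP[p [q [pq ->]]] /edgesP[r [s [rs ->]]] dis.
pose o (b : bool) : hypercube_factor 2 := Ordinal (leq_b1 b : b < 2).
pose V := kary_cube 2 3.
pose square : seq (bool * bool) :=
  [:: (false, false); (false, true); (true, true); (true, false)].
(* Face number d at height t consists of the vertices with d-th coordinate t. *)
pose face (d : nat) (t : bool) : seq V := [seq
  (match d with 0 => (o t, (o xy.1, o xy.2)) | 1 => (o xy.1, (o t, o xy.2))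
   | _ => (o xy.1, (o xy.2, o t)) end : V) | xy <- square].
pose on (c : seq V) (x y : V) :=
  (x \in c) && (next c x == y) || (y \in c) && (next c y == x).
have onP (c : seq V) x y : on c x y -> [set x; y] \in cycle_edges c.
  case/orP=> /andP[xc /eqP <-]; apply/imsetP; first by exists x.
  by exists y => //; rewrite setUC.
pose faces := [seq (d, t) | d <- [:: 0; 1; 2], t <- [:: false; true]].
pose vs : seq V := face 0 false ++ face 0 true.
have invs (x : V) : x \in vs.
  case: x => [[[|[|x1]] h1] [[[|[|x2]] h2] [[|[|x3]] h3]]] //;
  by rewrite /vs !inE !xpair_eqE -!val_eqE.
have key : all (fun p => all (fun q => all (fun r => all (fun s =>
    [&& adj p q, adj r s, p != r, p != s, q != r & q != s] ==>
    has (fun dt => on (face dt.1 dt.2) p q && on (face dt.1 (~~ dt.2)) r s) faces)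
    vs) vs) vs) vs by vm_compute.
have nin x : x \in [set p; q] -> x \notin [set r; s].
  by move=> xe; apply/negP => xf; move/setP/(_ x): dis; rewrite !in_setI xe xf inE.
have := nin p (set21 _ _); have := nin q (set22 _ _).
rewrite !in_set2 !negb_or => /andP[qr qs] /andP[pr ps].
move/allP/(_ p (invs p))/allP/(_ q (invs q)): key.
move=> /allP/(_ r (invs r))/allP/(_ s (invs s)).
rewrite pq rs pr ps qr qs => /hasP[[d t] _ /andP[/onP e1 /onP f2]].
have cyc d' t' : is_cycle (face d' t').
  by split; [case: d' => [|[|]] | case: d' t' => [|[|?]] []].
apply: (@dcc_of_disjoint _ _ _ (face d t) (face d (~~ t))) => //.
  have : all (fun x => x \notin face d (~~ t)) (face d t).
    by case: d t {e1 f2} => [|[|d]] [].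
  by move/allP.
by rewrite card_kary_cube //; case: d {e1 f2} => [|[|d]].
Qed.

Theorem corollary4p1 (k n : nat) (hk : 2 <= k) (k_even : ~~ odd k)
    (hn : 2 <= n) (hkn : (k, n) <> (2, 2)) :
  two_dcc_edge_bipancyclic (kary_cube k n) 4 #|kary_cube k n|./2.
Proof.
have n0 : 0 < n by lia.
have kn : [\/ 3 < k, 3 < n | k = 2 /\ n = 3].
  have [k2|k3] : k = 2 \/ 3 < k by lia.
    subst k; have n2 : n <> 2 by move=> n2; apply: hkn; rewrite n2.
    have [n3|n4] : n = 3 \/ 3 < n by lia.
      by constructor 3.
    by constructor 2.
  by constructor 1.
have card8 : 8 <= #|kary_cube k n|.
  rewrite card_kary_cube //; case: kn => [k3|n3|[-> ->] //].
  - by apply: (@leq_trans (k ^ 2)); [nia | apply: leq_pexp2l; lia].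
  - apply: (@leq_trans (2 ^ n)); first by rewrite (@leq_exp2l 2 3) //; lia.
    by rewrite leq_exp2r.
split; [exact: bipartite_cube | by lia | by lia | move=> e f ee ef dis l ol lb].
have torus : 3 < k \/ 3 < n -> dcc_through e f l.
  move=> kn'; have [a [b [v [cv ve vf]]]] := toroidal_cube hk k_even hn kn' ee ef.
  exact: torus_dcc cv ve vf dis ol lb.
case: kn => [k3|n3|[k2 n3]]; [by apply: torus; left|by apply: torus; right|].
subst k n; have -> : l = 4 by rewrite card_kary_cube // in lb; lia.
exact: Q3_faces.
Qed.
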